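(* Robert's body $\mathcal{R}$, constructed over a regular tetrahedron $abcd$ of edge length $2$, has the symmetry of the tetrahedron: every isometry of $\mathbb{R}^3$ mapping $\{a,b,c,d\}$ onto itself maps $\mathcal{R}$ onto itself. Moreover, the boundary of $\mathcal{R}$ is smooth except at the four vertices $a,b,c,d$, where it has vertex singularities: at every boundary point other than $a,b,c,d$ there is a unique support plane of $\mathcal{R}$, while at each of $a,b,c,d$ the normal cone of $\mathcal{R}$ has nonempty interior.
   Context: For points $p,q$, $pq$ denotes both the segment and its length. Confocal parabolas: two parabolas which in suitable coordinates are $z=\frac{x^2}{4\alpha}-\frac{\alpha}{2}$, $y=0$, and $z=-\frac{y^2}{4\alpha}+\frac{\alpha}{2}$, $x=0$ ($\alpha>0$). Parabolic pea pod device $\Sigma$. It is given by a plane $H$, a line $L\subset H$ (the axis), a circle in $H$ with center $c\in L$ and radius $r$ (the principal circle), and a chord $I$ of the circle perpendicular to $L$ (the longitudinal beam). The pea disks are the disks of $H$ inside the principal circle, tangent to it and to $I$, lying in the half plane of $H$ determined by $I$ opposite to $c$ (the endpoints of $I$ count as degenerate disks of radius $0$). Their centers lie on a parabola with focus $c$, the pea string; $E(\Sigma)$ is the closed sub-arc of it formed by these centers. For $x\in E(\Sigma)$, $R(x)$ is the radius of the pea disk centered at $x$. The bulb is the 3-dimensional ball with the same center and radius as the pea disk centered on $L$. Two such devices are convex confocal if they share the axis $L$, their planes are orthogonal, their pea strings are confocal parabolas, and the center of the principal circle of each one is the center of the bulb of the other. Robert's body $\mathcal{R}$. For each pair of opposite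 edges $pq$, $rs$ of the regular tetrahedron $abcd$ of edge length $2$ take the (unique) pair of convex confocal parabolic pea pod devices $\Sigma_{pq},\Sigma_{rs}$ with longitudinal beams $pq$ and $rs$. For $x\in E(\Sigma_{pq})$, $y\in E(\Sigma_{rs})$, let $\phi_{pq}(x,y)$ be the point of the line through $x$ and $y$ at distance $R(x)$ from $x$ with $x$ between $\phi_{pq}(x,y)$ and $y$. The wedge-pod surface of $pq$ is $\{\phi_{pq}(x,y): x\in E(\Sigma_{pq}),y\in E(\Sigma_{rs})\}$; put $\gamma_{r,pq}=\{\phi_{pq}(x,r):x\in E(\Sigma_{pq})\}$, a curve on the sphere of radius $2$ centered at $r$ joining $p$ to $q$ (and likewise $\gamma_{s,pq}$). Let $T$ be the intersection of the four closed balls of radius $2$ centered at $a,b,c,d$. For each vertex $r$ with opposite face $pqs$, the spherical cap of $r$ is the region of the sphere of radius $2$ centered at $r$ bounded by the simple closed curve $\gamma_{r,pq}\cup\gamma_{r,qs}\cup\gamma_{r,sp}$ and contained in the boundary of $T$. The union of the six wedge-pod surfaces and the four caps is the boundary of a body of constant width $2$, which is Robert's body $\mathcal{R}$. *)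

(* Defs.v *)
From mathcomp Require Import all_boot all_order all_algebra.
From mathcomp Require Import all_classical all_reals all_analysis.
Set Implicit Arguments.
Unset Strict Implicit.
Unset Printing Implicit Defensive.
Import Order.TTheory GRing.Theory Num.Theory.
Import numFieldNormedType.Exports.
Local Open Scope classical_set_scope.
Local Open Scope ring_scope.

(* The library norm `|x| on 'rV[R]_3 is the sup norm.  All metric notions
   below use the Euclidean norm instead; the topology is the same. *)
Notation E3 R := 'rV[R]_3.

Section Euclid.
Variable R : realType.
Implicit Types (x y z p q u : E3 R) (A H L P K : set (E3 R)).

Definition dot x y : R := \sum_(i < 3) x 0 i * y 0 i.
Definition enorm x : R := Num.sqrt (dot x x).
Definition dist x y : R := enorm (x - y).

Definition segment p q : set (E3 R) :=
  [set p + t *: (q - p) | t in [set t : R | 0 <= t <= 1]].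
Definition line_at p u : set (E3 R) := [set p + t *: u | t in [set: R]].
Definition plane_at p u : set (E3 R) := [set z | dot u (z - p) = 0].

Definition is_line L := exists p u, u != 0 /\ L = line_at p u.
Definition is_plane H := exists p u, u != 0 /\ H = plane_at p u.

Definition orthogonal_planes H1 H2 := exists p1 u1 p2 u2,
  [/\ u1 != 0, u2 != 0, H1 = plane_at p1 u1, H2 = plane_at p2 u2
    & dot u1 u2 = 0].

Definition closed_ball3 c (r : R) : set (E3 R) := [set z | dist z c <= r].
Definition sphere3 c (r : R) : set (E3 R) := [set z | dist z c = r].

Definition boundary A : set (E3 R) := closure A `\` interior A.

Definition euclidean_isometry (f : E3 R -> E3 R) :=
  forall x y, dist (f x) (f y) = dist x y.

Definition convex_body K :=
  [/\ compact K, convex_set (K : set (convex_lmodType (E3 R)))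
    & interior K !=set0].

Definition width K u : R :=
  sup [set dot u z | z in K] - inf [set dot u z | z in K].

Definition constant_width K (w : R) :=
  forall u, enorm u = 1 -> width K u = w.

Definition support_plane K x P := exists u,
  [/\ u != 0, P = plane_at x u & forall z, K z -> dot u (z - x) <= 0].

(* Empty when x is not in K, as usual. *)
Definition normal_cone K x : set (E3 R) :=
  [set u | K x /\ forall z, K z -> dot u (z - x) <= 0].

End Euclid.

Section Parabolas.
Variable R : realType.
Implicit Types (c : E3 R) (H D P : set (E3 R)).

Definition focal_parabola H c D : set (E3 R) :=
  [set z | H z /\ exists w, [/\ D w, dist z w = dist z c
                              & forall w', D w' -> dist z w <= dist z w']].

Definition is_parabola_with_focus H c P := exists D,
  [/\ is_line D, D `<=` H, ~ D c & P = focal_parabola H c D].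

Definition orthonormal_frame (e1 e2 e3 : E3 R) :=
  [/\ enorm e1 = 1, enorm e2 = 1, enorm e3 = 1, dot e1 e2 = 0
    & dot e1 e3 = 0 /\ dot e2 e3 = 0].

(* The coordinates (x, y, z) refer to the frame (o; e1, e2, e3).  The order of
   P1 and P2 is immaterial: exchange e1 with e2 and replace e3 by - e3. *)
Definition confocal_parabolas P1 P2 := exists o e1 e2 e3 (alpha : R),
  [/\ orthonormal_frame e1 e2 e3, 0 < alpha,
      P1 = [set o + x *: e1 + (x ^+ 2 / (4 * alpha) - alpha / 2) *: e3
             | x in [set: R]]
    & P2 = [set o + y *: e2 + (- (y ^+ 2 / (4 * alpha)) + alpha / 2) *: e3
             | y in [set: R]]].

End Parabolas.

Record device (R : realType) := Device {
  pod_plane : set (E3 R);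
  pod_axis : set (E3 R);
  pod_center : E3 R;
  pod_radius : R;
  beam_end1 : E3 R;
  beam_end2 : E3 R }.

Section Pods.
Variable R : realType.
Implicit Types (S : device R) (x y z p q r s : E3 R).

Definition principal_circle S : set (E3 R) :=
  [set z | pod_plane S z /\ dist z (pod_center S) = pod_radius S].
Definition principal_disk S : set (E3 R) :=
  [set z | pod_plane S z /\ dist z (pod_center S) <= pod_radius S].
Definition beam S : set (E3 R) := segment (beam_end1 S) (beam_end2 S).
Definition beam_line S : set (E3 R) :=
  line_at (beam_end1 S) (beam_end2 S - beam_end1 S).

(* The closed half plane bounded by the beam line and opposite to the center;
   it is determined because is_pod keeps the center off the beam. *)
Definition opposite_half_plane S : set (E3 R) :=
  [set z | pod_plane S z /\
           exists w, beam_line S w /\ segment (pod_center S) z w].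

Definition is_pod S :=
  [/\ is_plane (pod_plane S),
      is_line (pod_axis S) /\ pod_axis S `<=` pod_plane S,
      pod_axis S (pod_center S) /\ 0 < pod_radius S,
      [/\ principal_circle S (beam_end1 S), principal_circle S (beam_end2 S)
        & beam_end1 S != beam_end2 S]
    & (forall z w, pod_axis S z -> pod_axis S w ->
         dot (z - w) (beam_end1 S - beam_end2 S) = 0)
      /\ ~ beam S (pod_center S)].

Definition plane_disk S x (rho : R) : set (E3 R) :=
  [set z | pod_plane S z /\ dist z x <= rho].

(* Tangency is expressed by having exactly one common point.  For rho = 0 the
   conditions say that x is an endpoint of the beam. *)
Definition pea_disk S x (rho : R) :=
  [/\ pod_plane S x /\ 0 <= rho,
      plane_disk S x rho `<=` principal_disk S,
      exists t, plane_disk S x rho `&` principal_circle S = [set t],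
      exists t, plane_disk S x rho `&` beam S = [set t]
    & plane_disk S x rho `<=` opposite_half_plane S].

(* E(S) *)
Definition pea_arc S : set (E3 R) := [set x | exists rho, pea_disk S x rho].

Definition is_pea_string S (P : set (E3 R)) :=
  is_parabola_with_focus (pod_plane S) (pod_center S) P /\ pea_arc S `<=` P.

Definition bulb_center S x := pod_axis S x /\ pea_arc S x.

Definition convex_confocal S1 S2 :=
  [/\ is_pod S1 /\ is_pod S2,
      pod_axis S1 = pod_axis S2,
      orthogonal_planes (pod_plane S1) (pod_plane S2),
      exists P1 P2, [/\ is_pea_string S1 P1, is_pea_string S2 P2
                      & confocal_parabolas P1 P2]
    & bulb_center S2 (pod_center S1) /\ bulb_center S1 (pod_center S2)].

(* The point of the line xy at distance rho from x, beyond x as seen from y. *)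
Definition phi x (rho : R) y : E3 R := x + (rho / dist x y) *: (x - y).

Definition pod_pair p q r s S1 S2 :=
  [/\ convex_confocal S1 S2, beam S1 = segment p q & beam S2 = segment r s].

(* For opposite edges pq, rs of the tetrahedron the pair (S1, S2) is unique up
   to naming the endpoints of the beams, so the existential over pairs in the
   next two definitions is a reference to that pair. *)
Definition wedge_pod p q r s : set (E3 R) := [set z | exists S1 S2 x rho y,
  [/\ pod_pair p q r s S1 S2, pea_disk S1 x rho, pea_arc S2 y
    & z = phi x rho y]].

(* The curve gamma_(r,pq), where rs is the edge opposite to pq. *)
Definition gamma p q r s : set (E3 R) := [set z | exists S1 S2 x rho,
  [/\ pod_pair p q r s S1 S2, pea_disk S1 x rho & z = phi x rho r]].

End Pods.

Section Robert.
Variable R : realType.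
Implicit Types (v : 'I_4 -> E3 R) (K : set (E3 R)).

Definition regular_tetrahedron v (l : R) :=
  forall i j, i != j -> dist (v i) (v j) = l.

Definition reuleaux v : set (E3 R) :=
  [set z | forall i, closed_ball3 (v i) 2 z].

(* The closed curve on the sphere of radius 2 around v k made of the three
   curves attached to the edges of the face opposite to v k. *)
Definition cap_curve v (k : 'I_4) : set (E3 R) :=
  [set z | exists i j l, uniq [:: i; j; k; l] /\
                         gamma (v i) (v j) (v k) (v l) z].

Definition punctured_sphere v k : set (E3 R) :=
  sphere3 (v k) 2 `\` cap_curve v k.

(* The cap of v k: the curve together with the region of the sphere that it
   bounds, i.e. the connected component of its complement in the sphere,
   contained in the boundary of the Reuleaux tetrahedron. *)
Definition spherical_cap v k : set (E3 R) :=
  cap_curve v k `|`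
  [set z | punctured_sphere v k z /\
     connected_component (punctured_sphere v k) z `<=` boundary (reuleaux v)].

Definition wedge_pods v : set (E3 R) :=
  [set z | exists i j k l, uniq [:: i; j; k; l] /\
                           wedge_pod (v i) (v j) (v k) (v l) z].

Definition robert_surface v : set (E3 R) :=
  wedge_pods v `|` \bigcup_(k in [set: 'I_4]) spherical_cap v k.

(* K is the body of constant width 2 bounded by the surface; there is only one,
   a convex body being the convex hull of its boundary. *)
Definition robert_body v K :=
  [/\ convex_body K, constant_width K 2 & boundary K = robert_surface v].

End Robert.

(* Main.v *)
Require Import Defs.
From mathcomp Require Import all_boot all_order all_algebra.
From mathcomp Require Import all_classical all_reals all_analysis.
From mathcomp Require Import ring lra.
Import Order.TTheory GRing.Theory Num.Theory.
Import numFieldNormedType.Exports.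
Local Open Scope classical_set_scope.
Local Open Scope ring_scope.

(** The only facts about the caps that matter are that their points lie at
    distance 2 from a vertex and that the vertices belong to the body.  In a
    body [K] of constant width 2 the unit normals [u] at [x] correspond to the
    points [x - 2 u] of [K] at distance 2 from [x].

    Solving for the devices, the centers of the pea disks of the beam [pq] are
    [m + rho b e + b (p - q) / 2] with [|b| <= 1], radius
    [rho b = kap (1 - b^2)], [m] the midpoint of [pq] and [e] the unit vector
    from the midpoint of [rs] to [m]; in particular wedge points are given by a
    formula that every isometry respects, and the point with parameters [(b, t)]
    of the wedge of [pq] is at distance 2 from the point [(t, b)] of the wedge of
    [rs].  A critical point computation shows that the latter is the only point
    of [K] at distance 2 from the former when [|b|, |t| < 1].

    If a boundary point [x] other than a vertex had two unit normals, an arc of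
    the circle of radius 2 around [x] would lie in the boundary of [K].  All but
    finitely many points [y] of it are at distance different from 2 from the
    vertices, hence are wedge points with [|b|, |t| < 1].  Then [x] is the point
    opposite to [y], itself such a wedge point, and has a single normal.

    Consequently [K] is the set of points at distance at most 2 from all the
    wedge points, which makes it symmetric, and the normal cone at a vertex
    contains the differences with the three other vertices. *)

Set Implicit Arguments.
Unset Strict Implicit.
Unset Printing Implicit Defensive.

Ltac vec := apply/rowP => ?; rewrite !mxE; (ring || (by field) || (field; lra)).

(** * Euclidean geometry in coordinates *)

Section Euclid.
Variable R : realType.
Implicit Types (x y z u : E3 R) (t : R).

Lemma dotE x y : dot x y = x 0 0 * y 0 0 + x 0 1 * y 0 1 + x 0 2%:R * y 0 2%:R.
Proof.
rewrite /dot !big_ord_recl big_ord0 addr0 addrA.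
by congr (_ + _ + _); congr (x _ _ * y _ _); apply/val_inj.
Qed.

Lemma dotC x y : dot x y = dot y x.
Proof. by rewrite !dotE; ring. Qed.

Lemma dotDl x y z : dot (x + y) z = dot x z + dot y z.
Proof. by rewrite !dotE !mxE; ring. Qed.

Lemma dotZl t x z : dot (t *: x) z = t * dot x z.
Proof. by rewrite !dotE !mxE; ring. Qed.

Lemma dotNl x z : dot (- x) z = - dot x z.
Proof. by rewrite !dotE !mxE; ring. Qed.

Lemma dotDr x y z : dot z (x + y) = dot z x + dot z y.
Proof. by rewrite !dotE !mxE; ring. Qed.

Lemma dotZr t x z : dot z (t *: x) = t * dot z x.
Proof. by rewrite !dotE !mxE; ring. Qed.

Lemma dotNr x z : dot z (- x) = - dot z x.
Proof. by rewrite !dotE !mxE; ring. Qed.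

Lemma dot0l x : dot 0 x = 0.
Proof. by rewrite !dotE !mxE; ring. Qed.

Lemma dot0r x : dot x 0 = 0.
Proof. by rewrite !dotE !mxE; ring. Qed.

Definition dot_lin := (dotDl, dotDr, dotZl, dotZr, dotNl, dotNr).

Lemma dot_ge0 x : 0 <= dot x x.
Proof. by rewrite dotE; nra. Qed.

Lemma dot_eq0 x : dot x x = 0 -> x = 0.
Proof.
rewrite dotE => h; apply/rowP => i; rewrite mxE.
have [-> | [-> | ->]] : i = 0 \/ i = 1 \/ i = 2%:R.
  case: i => [[|[|[|//]]] hi]; [left|right;left|right;right]; exact/val_inj.
- by apply/eqP; rewrite -sqrf_eq0; apply/eqP; nra.
- by apply/eqP; rewrite -sqrf_eq0; apply/eqP; nra.
- by apply/eqP; rewrite -sqrf_eq0; apply/eqP; nra.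
Qed.

Lemma dot_gt0 x : x != 0 -> 0 < dot x x.
Proof.
by move=> x0; rewrite lt_neqAle dot_ge0 andbT eq_sym; apply: contra_neq x0 => /dot_eq0.
Qed.

Lemma dot_CS x y : dot x y ^+ 2 <= dot x x * dot y y.
Proof.
rewrite -subr_ge0 !dotE.
set a := x 0 0; set b := x 0 1; set c := x 0 _.
set d := y 0 0; set e := y 0 1; set f := y 0 _.
rewrite [leRHS](_ : _ = (a * e - b * d) ^+ 2 + (a * f - c * d) ^+ 2 + (b * f - c * e) ^+ 2); last by ring.
by rewrite !addr_ge0 ?sqr_ge0.
Qed.

Lemma enorm_ge0 x : 0 <= enorm x.
Proof. exact: sqrtr_ge0. Qed.

Lemma enorm_sq x : enorm x ^+ 2 = dot x x.
Proof. by rewrite sqr_sqrtr ?dot_ge0. Qed.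

Lemma enorm_le x t : 0 <= t -> (enorm x <= t) = (dot x x <= t ^+ 2).
Proof. by move=> t0; rewrite -enorm_sq ler_sqr // nnegrE ?enorm_ge0. Qed.

Lemma enormE x t : 0 <= t -> enorm x = t <-> dot x x = t ^+ 2.
Proof.
move=> t0; rewrite -enorm_sq; split=> [->//|/eqP].
by rewrite eqrXn2 ?enorm_ge0 // => /eqP.
Qed.

Lemma enorm1P x : enorm x = 1 <-> dot x x = 1.
Proof. by rewrite enormE // expr1n. Qed.

Lemma enorm_gt0 x : x != 0 -> 0 < enorm x.
Proof. by move=> x0; rewrite sqrtr_gt0 dot_gt0. Qed.

Lemma enormN x : enorm (- x) = enorm x.
Proof. by rewrite /enorm dotNl dotNr opprK. Qed.

Lemma enormZ t x : enorm (t *: x) = `|t| * enorm x.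
Proof. by rewrite /enorm dotZl dotZr mulrA -expr2 sqrtrM ?sqr_ge0// sqrtr_sqr. Qed.

Lemma dot_le_enorm x y : dot x y <= enorm x * enorm y.
Proof.
apply: le_trans (ler_norm _) _.
by rewrite -sqrtr_sqr -sqrtrM ?dot_ge0 // ler_wsqrtr // dot_CS.
Qed.

Lemma enormD x y : enorm (x + y) <= enorm x + enorm y.
Proof.
rewrite enorm_le ?addr_ge0 ?enorm_ge0 // sqrrD !enorm_sq !dot_lin (dotC y x).
by have := dot_le_enorm x y; lra.
Qed.

Lemma distC x y : dist x y = dist y x.
Proof. by rewrite /dist -opprB enormN. Qed.

Lemma dist2_sq x y : dist x y = 2 -> dot (x - y) (x - y) = 4.
Proof. by move=> H; rewrite -enorm_sq -/(dist x y) H; ring. Qed.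

Lemma dist_eq0 x y : dist x y = 0 -> x = y.
Proof.
move=> H; apply/eqP; rewrite -subr_eq0; apply/eqP; apply: dot_eq0.
by rewrite -enorm_sq -/(dist x y) H expr0n.
Qed.

Lemma distxx x : dist x x = 0.
Proof. by rewrite /dist subrr /enorm dot0l sqrtr0. Qed.

Lemma dist_triangle y x z : dist x z <= dist x y + dist y z.
Proof. by rewrite /dist (_ : x - z = (x - y) + (y - z)) ?enormD // addrA subrK. Qed.

Lemma enorm_unit x : x != 0 -> enorm ((enorm x)^-1 *: x) = 1.
Proof.
move=> x0; rewrite enormZ ger0_norm ?invr_ge0 ?enorm_ge0 //.
by rewrite mulVf // gt_eqF // enorm_gt0.
Qed.

Definition onf (e1 e2 e3 : E3 R) :=
  [/\ dot e1 e1 = 1, dot e2 e2 = 1 & dot e3 e3 = 1] /\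
  [/\ dot e1 e2 = 0, dot e1 e3 = 0 & dot e2 e3 = 0].

(** The matrix [M] with rows [e1], [e2], [e3] satisfies [M *m M^T = 1], hence also [M^T *m M = 1],
    and the expansion is [z *m M^T *m M]. *)
Lemma onf_expand e1 e2 e3 : onf e1 e2 e3 ->
  forall z, z = dot z e1 *: e1 + dot z e2 *: e2 + dot z e3 *: e3.
Proof.
case=> -[h1 h2 h3] [h12 h13 h23] z.
pose s (i : 'I_3) := if i == 0 then e1 else if i == 1 then e2 else e3.
pose M := \matrix_(i < 3, j < 3) s i 0 j.
have MM : M *m M^T = 1%:M.
  apply/matrixP => i j; rewrite !mxE.
  under eq_bigr do rewrite !mxE.
  rewrite -/(dot (s i) (s j)).
  have C k : [\/ k = 0, k = 1 | k = 2%:R :> 'I_3].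
    case: k => [[|[|[|//]]] hi]; [constructor 1|constructor 2|constructor 3]; exact/val_inj.
  by case: (C i) => ->; case: (C j) => -> /=; rewrite /s /= ?(dotC e2 e1) ?(dotC e3 e1) ?(dotC e3 e2).
have MM' : M^T *m M = 1%:M by apply: mulmx1C.
rewrite -[LHS]mulmx1 -MM' mulmxA.
apply/rowP => j; rewrite !mxE !big_ord_recl big_ord0 addr0 !mxE /s /=.
rewrite addrA; congr (_ * _ + _ * _ + _ * _);
  by rewrite /dot; apply: eq_bigr => k _; rewrite !mxE.
Qed.

Lemma onf_eq0 e1 e2 e3 : onf e1 e2 e3 ->
  forall z, dot z e1 = 0 -> dot z e2 = 0 -> dot z e3 = 0 -> z = 0.
Proof. by move=> /onf_expand H z h1 h2 h3; rewrite [LHS]H h1 h2 h3 !scale0r !addr0. Qed.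

End Euclid.

(** * Pea disks of a device in an adapted frame *)

Section PodFrame.
Variable R : realType.
Implicit Types (S : device R) (c e f u x z : E3 R) (a b h l rho : R).

Definition pt c e f a b : E3 R := c + a *: e + b *: f.

Lemma dist_pt c e f u a b a' b' : onf e f u ->
  dot (pt c e f a b - pt c e f a' b') (pt c e f a b - pt c e f a' b') =
  (a - a') ^+ 2 + (b - b') ^+ 2.
Proof.
case=> -[h1 h2 h3] [h12 h13 h23].
rewrite (_ : _ - _ = (a - a') *: e + (b - b') *: f).
  by rewrite !dot_lin (dotC f e) h1 h2 h12; ring.
by apply/rowP => i; rewrite !mxE; ring.
Qed.

Lemma sqrD_le0 a b : a ^+ 2 + b ^+ 2 <= 0 -> a = 0 /\ b = 0.
Proof.
move=> H; have := sqr_ge0 a; have := sqr_ge0 b => hb ha.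
by split; apply/eqP; rewrite -sqrf_eq0; apply/eqP; lra.
Qed.

Lemma pt0 c e f : c = pt c e f 0 0.
Proof. by rewrite /pt !scale0r !addr0. Qed.

Lemma pt_inj c e f u a b a' b' : onf e f u ->
  pt c e f a b = pt c e f a' b' -> a = a' /\ b = b'.
Proof.
move=> on E; have := dist_pt c a b a' b' on; rewrite E subrr dot0l => H.
have [] : a - a' = 0 /\ b - b' = 0 by apply: sqrD_le0; rewrite -H.
by lra.
Qed.

(** Coordinates adapted to a device: the origin is the center of the principal circle, [e] runs
    along the axis towards the beam, [f] along the beam, and [u] is normal to the plane. The beam is
    at height [h] and has half length [l]. *)
Record pod_frame S e f u h l : Prop := PodFrame {
  pf_on : onf e f u;
  pf_h : 0 < h;
  pf_l : 0 < l;
  pf_r : 0 < pod_radius S;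
  pf_rhl : pod_radius S ^+ 2 = h ^+ 2 + l ^+ 2;
  pf_plane : forall z, pod_plane S z <-> dot u (z - pod_center S) = 0;
  pf_axis : forall z, pod_axis S z <-> exists a, z = pod_center S + a *: e;
  pf_end1 : beam_end1 S = pt (pod_center S) e f h l;
  pf_end2 : beam_end2 S = pt (pod_center S) e f h (- l) }.

Lemma pf_planeP S e f u h l z : pod_frame S e f u h l ->
  pod_plane S z <-> exists a b, z = pt (pod_center S) e f a b.
Proof.
case=> on _ _ _ _ HP _ _ _; split=> [/HP H|[a [b ->]]].
  exists (dot (z - pod_center S) e), (dot (z - pod_center S) f).
  rewrite /pt -addrA; apply/eqP; rewrite addrC -subr_eq; apply/eqP.
  by rewrite {1}[LHS](onf_expand on) (dotC _ u) H scale0r addr0.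
apply/HP; case: on => _ [_ h1 h2].
rewrite /pt (_ : _ - _ = a *: e + b *: f); last by apply/rowP => i; rewrite !mxE; ring.
by rewrite !dot_lin (dotC u e) (dotC u f) h1 h2; ring.
Qed.

Lemma dist_pt_le c e f u a b a' b' t : onf e f u -> 0 <= t ->
  dist (pt c e f a b) (pt c e f a' b') <= t <->
  (a - a') ^+ 2 + (b - b') ^+ 2 <= t ^+ 2.
Proof. by move=> on t0; rewrite /dist enorm_le // (dist_pt _ _ _ _ _ on). Qed.

Lemma dist_pt_eq c e f u a b a' b' t : onf e f u -> 0 <= t ->
  dist (pt c e f a b) (pt c e f a' b') = t <->
  (a - a') ^+ 2 + (b - b') ^+ 2 = t ^+ 2.
Proof. by move=> on t0; rewrite /dist enormE // (dist_pt _ _ _ _ _ on). Qed.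

Lemma pf_beam S e f u h l z : pod_frame S e f u h l ->
  beam S z <-> exists2 b, `|b| <= l & z = pt (pod_center S) e f h b.
Proof.
move=> F; have l0 := pf_l F; rewrite /beam /segment (pf_end1 F) (pf_end2 F).
split=> [[t /= t01 <-]|[b bl ->]].
  exists (l - 2 * t * l); first by rewrite ler_norml; apply/andP; nra.
  by apply/rowP => i; rewrite !mxE; ring.
exists ((l - b) / (2 * l)) => /=.
  move: bl; rewrite ler_norml => /andP[b1 b2].
  by rewrite divr_ge0 ?ler_pdivrMr /=; lra.
by apply/rowP => i; rewrite !mxE; field; lra.
Qed.

Lemma pf_half_plane S e f u h l a b : pod_frame S e f u h l ->
  opposite_half_plane S (pt (pod_center S) e f a b) <-> h <= a.
Proof.
move=> F; have h0 := pf_h F; have l0 := pf_l F; have on := pf_on F.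
split=> [[_ [w [[t /= _ Et] [t' /= /andP[t0 t1] Et']]]]|ha].
  have : pt (pod_center S) e f (t' * a) (t' * b) = pt (pod_center S) e f h (l - 2 * t * l).
    move: Et Et'; rewrite (pf_end1 F) (pf_end2 F) => Et Et'.
    transitivity w; [rewrite -Et'|rewrite -Et]; by apply/rowP => i; rewrite !mxE; ring.
  move=> /(pt_inj on)[Eh _]; case: (lerP a 0) => a0; nra.
split; first by apply/(pf_planeP _ F); exists a, b.
exists (pt (pod_center S) e f h (h / a * b)); split.
  rewrite /beam_line (pf_end1 F) (pf_end2 F).
  exists ((l - h / a * b) / (2 * l)) => //.
  by apply/rowP => i; rewrite !mxE; field; apply/andP; split; lra.
exists (h / a) => /=.
  by rewrite divr_ge0 ?ler_pdivrMr ?mul1r //=; lra.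
by apply/rowP => i; rewrite !mxE; field; lra.
Qed.

(* With [rho] the radius, tangency to the beam puts the center at height
   [h + rho], and tangency to the principal circle gives
   [(h + rho)^2 + b^2 = (r - rho)^2]. *)
Lemma pea_diskP S e f u h l x rho : pod_frame S e f u h l ->
  pea_disk S x rho <->
  exists2 b, `|b| <= l & rho = (l ^+ 2 - b ^+ 2) / (2 * (pod_radius S + h)) /\
                       x = pt (pod_center S) e f (h + rho) b.
Proof.
move=> F; have h0 := pf_h F; have l0 := pf_l F; have on := pf_on F.
have r0 := pf_r F; have rhl := pf_rhl F.
set c := pod_center S in F on *; set r := pod_radius S in r0 rhl *.
have rh : h < r by nra.
split.
  case=> -[/(pf_planeP _ F)[a [b Ex]] rho0] Hsub [t Ht] [t' Ht'] Hop.
  rewrite -/c in Ex.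
  have in_disk a' b' : (a' - a) ^+ 2 + (b' - b) ^+ 2 <= rho ^+ 2 ->
      plane_disk S x rho (pt c e f a' b').
    move=> H; split; first by apply/(pf_planeP _ F); exists a', b'.
    by rewrite Ex; apply/(dist_pt_le _ _ _ _ _ on).
  have ha : h <= a - rho.
    by apply/(pf_half_plane _ b F); apply: Hop; apply: in_disk; nra.
  (* The whole disk lies at height at least [h], so its common point with the beam must be its
     lowest point. *)
  have [a_eq bl] : a = h + rho /\ `|b| <= l.
    have [] : (plane_disk S x rho `&` beam S) t' by rewrite Ht'.
    move=> [_ Hd] /(pf_beam _ F)[b' b'l Et'].
    move: Hd; rewrite Et' Ex -/c => /(dist_pt_le _ _ _ _ _ on) -/(_ rho0) Hd.
    have Ea : a = h + rho.
      suff : a - h <= rho by lra.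
      rewrite -ler_sqr ?nnegrE; [|lra..].
      by have := sqr_ge0 (b' - b); lra.
    have -> : b = b'.
      have [] : 0 = 0 :> R /\ b' - b = 0 by apply: sqrD_le0; rewrite Ea in Hd; lra.
      by lra.
    by [].
  exists b => //; split; last by rewrite Ex a_eq.
  pose D := Num.sqrt (a ^+ 2 + b ^+ 2).
  have D2 : D ^+ 2 = a ^+ 2 + b ^+ 2 by rewrite sqr_sqrtr // addr_ge0 ?sqr_ge0.
  have Dp : 0 < D by rewrite sqrtr_gt0; nra.
  (* [D] is the distance from the center of the principal circle to [x]. The disk point farthest
     from that center lies on the ray through [x], at distance [D + rho]. *)
  have D_le : D + rho <= r.
    have /Hsub[_] : plane_disk S x rho (pt c e f (a + rho * a / D) (b + rho * b / D)).
      apply: in_disk; rewrite [leLHS](_ : _ = (rho / D) ^+ 2 * D ^+ 2); last first.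
        by rewrite D2; field; lra.
      by rewrite exprMn exprVn mulfVK // sqrf_eq0; lra.
    rewrite -/c {2}(pt0 c e f) => /(dist_pt_le _ _ _ _ _ on) -/(_ (ltW r0)).
    rewrite [leLHS](_ : _ = (1 + rho / D) ^+ 2 * (a ^+ 2 + b ^+ 2)); last by field; lra.
    rewrite -D2 (_ : _ * _ = (D + rho) ^+ 2); last by field; lra.
    by rewrite -/r ler_sqr ?nnegrE; lra.
  have D_ge : r <= D + rho.
    have [] : (plane_disk S x rho `&` principal_circle S) t by rewrite Ht.
    move=> [_ h1] [_ h2]; rewrite /r -h2 -/c.
    apply: le_trans (dist_triangle x _ _) _; rewrite addrC lerD //.
    by rewrite Ex {2}(pt0 c e f); apply/(dist_pt_le _ _ _ _ _ on); [lra|rewrite !subr0 D2].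
  have DD : D = r - rho by lra.
  have := D2; rewrite DD a_eq => E.
  by apply: (canRL (mulfK _)); first lra; nra.
case=> b bl [Erho Ex].
have b2 : b ^+ 2 <= l ^+ 2 by rewrite -[b ^+ 2]real_normK ?num_real // ler_sqr ?nnegrE //; lra.
have Erho2 : rho * (2 * (r + h)) = l ^+ 2 - b ^+ 2 by rewrite Erho divfK //; lra.
have rho0 : 0 <= rho by rewrite Erho divr_ge0; lra.
have rhor : rho < r.
  by rewrite -(@ltr_pM2r _ (2 * (r + h))) ?Erho2; nra.
pose D := r - rho.
have D0 : 0 < D by rewrite /D; lra.
have D2 : D ^+ 2 = (h + rho) ^+ 2 + b ^+ 2 by rewrite /D; nra.
have dxc : dist x c = D.
  rewrite Ex {2}(pt0 c e f); apply/(dist_pt_eq _ _ _ _ _ on); first lra.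
  by rewrite !subr0 D2.
have px : pod_plane S x by apply/(pf_planeP _ F); exists (h + rho), b.
have disk_pt z : plane_disk S x rho z -> exists a' b', z = pt c e f a' b' /\
    (a' - (h + rho)) ^+ 2 + (b' - b) ^+ 2 <= rho ^+ 2.
  case=> /(pf_planeP _ F)[a' [b' ->]] H; exists a', b'; split=> //.
  by move: H; rewrite Ex => /(dist_pt_le _ _ _ _ _ on); apply.
split=> //.
- move=> z [pz dz]; split=> //; apply: le_trans (dist_triangle x _ _) _.
  by rewrite -/c dxc /D -/r; lra.
(* The point of tangency is where the ray from [c] through [x] meets the principal circle. It is the
   only common point because [H3] is the equality case of the Cauchy-Schwarz inequality. *)
- exists (pt c e f (r / D * (h + rho)) (r / D * b)).
  apply/seteqP; split=> z /=.
    move=> [/disk_pt[a' [b' [-> H1]]] [_]].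
    rewrite -/c {2}(pt0 c e f) => /(dist_pt_eq _ _ _ _ _ on) -/(_ (ltW r0)).
    rewrite !subr0 -/r => H2.
    have H3 : r * D <= a' * (h + rho) + b' * b by rewrite /D in D2 *; nra.
    have H4 : (D * a' - r * (h + rho)) ^+ 2 + (D * b' - r * b) ^+ 2 <= 0.
      rewrite [leLHS](_ : _ = D ^+ 2 * (a' ^+ 2 + b' ^+ 2)
         + r ^+ 2 * ((h + rho) ^+ 2 + b ^+ 2) - 2 * r * D * (a' * (h + rho) + b' * b)); last by ring.
      rewrite H2 -D2 (_ : _ - _ = 2 * (r * D) * (r * D - (a' * (h + rho) + b' * b))); last by ring.
      by rewrite pmulr_rle0 ?mulr_gt0 // subr_le0.
    have [E1 E2] : D * a' = r * (h + rho) /\ D * b' = r * b.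
      by split; apply/eqP; rewrite -subr_eq0 -sqrf_eq0; apply/eqP;
        have := sqr_ge0 (D * a' - r * (h + rho)); have := sqr_ge0 (D * b' - r * b); lra.
    have -> : r / D * (h + rho) = a'.
      by rewrite mulrAC -E1 mulrC mulrA mulVf ?mul1r //; lra.
    by have -> : r / D * b = b' by rewrite mulrAC -E2 mulrC mulrA mulVf ?mul1r //; lra.
  have pz : pod_plane S (pt c e f (r / D * (h + rho)) (r / D * b)).
    by apply/(pf_planeP _ F); exists (r / D * (h + rho)), (r / D * b).
  move=> ->; split; split=> //.
    rewrite Ex; apply/(dist_pt_le _ _ _ _ _ on) => //.
    rewrite [leLHS](_ : _ = ((r - D) / D) ^+ 2 * ((h + rho) ^+ 2 + b ^+ 2)); last by field; lra.
    rewrite -D2 -exprMn divfK; last by lra.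
    by rewrite /D opprB addrC subrK.
  rewrite -/c {2}(pt0 c e f); apply/(dist_pt_eq _ _ _ _ _ on); first by rewrite ltW.
  rewrite !subr0 [LHS](_ : _ = (r / D) ^+ 2 * ((h + rho) ^+ 2 + b ^+ 2)); last by ring.
  by rewrite -D2 -exprMn divfK //; lra.
- exists (pt c e f h b); apply/seteqP; split=> z /=.
    move=> [/disk_pt[a' [b' [-> H1]]] /(pf_beam _ F)[b'' _ /(pt_inj on)[Ea Eb]]].
    rewrite Ea; congr (pt _ _ _ _ _); apply/eqP; rewrite -subr_eq0 -sqrf_eq0; apply/eqP.
    by have := sqr_ge0 (b' - b); rewrite Ea in H1; nra.
  move=> ->; split; last by apply/(pf_beam _ F); exists b.
  split; first by apply/(pf_planeP _ F); exists h, b.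
  by rewrite Ex; apply/(dist_pt_le _ _ _ _ _ on) => //; nra.
- move=> z /disk_pt[a' [b' [-> H1]]]; apply/(pf_half_plane _ _ F).
  by have := sqr_ge0 (b' - b); nra.
Qed.

End PodFrame.

(** * Existence of an adapted frame for every device *)

Section PodFrameExists.
Variable R : realType.

(** Take [e] along the vector [w] from the center to the midpoint of the beam and [f] along the
    beam. They are orthogonal because the beam ends are equidistant from the center, and [w] is
    nonzero because the center is off the beam. The axis direction is orthogonal to [f] and [u],
    hence parallel to [e]. *)
Lemma is_pod_frame (S : device R) : is_pod S ->
  exists e f u h l, pod_frame S e f u h l.
Proof.
case=> -[p0 [u0 [u0n EH]]] [[p1 [d [d0 EL]]] Lsub] [Lc r0].
set c := pod_center S in Lc *; set b1 := beam_end1 S; set b2 := beam_end2 S.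
case=> -[H1 d1] [H2 d2] b12 [Lperp ncb].
have Hdot z : pod_plane S z <-> dot u0 (z - c) = 0.
  have /= := Lsub _ Lc; rewrite EH /plane_at /= => Hc.
  by rewrite (_ : z - p0 = (z - c) + (c - p0)); [rewrite dotDr Hc addr0|vec].
rewrite -/b1 -/b2 -/c in H1 H2 d1 d2 b12 Lperp ncb.
set A : E3 R := b1 - c; set B : E3 R := b2 - c.
set n : E3 R := b1 - b2; set w : E3 R := 2^-1 *: (A + B).
have En : n = A - B by vec.
have En' : n = b1 - b2 by [].
have n0 : n != 0 by rewrite subr_eq0.
have w0 : w != 0.
  apply/eqP => w0; apply: ncb; exists 2^-1 => /=; first by lra.
  rewrite -/b1 -/b2 -[RHS]addr0 -w0.
  by apply/rowP => i; rewrite !mxE; field.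
have uA : dot u0 A = 0 by apply/Hdot.
have uB : dot u0 B = 0 by apply/Hdot.
have rr := ltW r0.
have Ew : w = 2^-1 *: (A + B) by [].
have EA : b1 = c + A by vec.
have EB : b2 = c + B by vec.
have AA : dot A A = pod_radius S ^+ 2 by apply/enormE.
have BB : dot B B = pod_radius S ^+ 2 by apply/enormE.
clearbody A B n w.
have wn : dot w n = 0.
  by rewrite En Ew !dot_lin (dotC B A) AA BB; ring.
have u0w : dot u0 w = 0 by rewrite Ew !dot_lin uA uB; ring.
have u0n' : dot u0 n = 0 by rewrite En !dot_lin uA uB; ring.
pose e : E3 R := (enorm w)^-1 *: w; pose f : E3 R := (enorm n)^-1 *: n.
pose u : E3 R := (enorm u0)^-1 *: u0.
have on : onf e f u.
  split; split; try by apply/enorm1P/enorm_unit.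
  - by rewrite !dot_lin wn; ring.
  - by rewrite !dot_lin (dotC w) u0w; ring.
  - by rewrite !dot_lin (dotC n) u0n'; ring.
have nw := enorm_gt0 w0; have nn := enorm_gt0 n0; have nu := enorm_gt0 u0n.
exists e, f, u, (enorm w), (enorm n / 2); split=> //.
- by rewrite divr_gt0.
- rewrite exprMn !enorm_sq -AA (_ : A = w + 2^-1 *: n); last first.
    by rewrite En Ew; apply/rowP => i; rewrite !mxE; field.
  by rewrite !dot_lin (dotC n) wn; field.
- move=> z; rewrite Hdot dotZl -/c; split=> [->|/eqP]; first by rewrite mulr0.
  by rewrite mulf_eq0 invr_eq0 gt_eqF //= => /eqP.
- have Hd1 : pod_axis S (p1 + d) by rewrite EL; exists 1; [|rewrite scale1r].
  have Hd0 : pod_axis S p1 by rewrite EL; exists 0; [|rewrite scale0r addr0].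
  have dn : dot d n = 0 by rewrite -(Lperp _ _ Hd1 Hd0) -En'; congr dot; vec.
  have du : dot d u0 = 0.
    have /Hdot e1 := Lsub _ Hd1; have /Hdot e2 := Lsub _ Hd0.
    by rewrite dotC (_ : d = (p1 + d - c) - (p1 - c)); [rewrite dotDr dotNr e1 e2 subr0|vec].
  have Ed : d = dot d e *: e.
    rewrite {1}[LHS](onf_expand on) {2}/f {2}/u !dotZr dn du !mulr0 !scale0r.
    by rewrite !addr0.
  have de : dot d e != 0 by apply: contra_neq d0 => H; rewrite Ed H scale0r.
  have [t0 _ Ec] : line_at p1 d c by rewrite -EL.
  move=> z; rewrite EL -/c -Ec; split=> [[t _ <-]|[a ->]].
    exists ((t - t0) * dot d e); rewrite -scalerA -Ed.
    by apply/rowP => i; rewrite !mxE; ring.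
  exists (t0 + a / dot d e) => //.
  by rewrite scalerDl -addrA; congr (_ + (_ + _)); rewrite [X in _ *: X]Ed scalerA divfK.
- rewrite /pt !scalerA mulfV ?gt_eqF // mulrAC mulfV ?gt_eqF // scale1r mul1r.
  by rewrite -/b1 EA En Ew -/c; vec.
- rewrite /pt scaleNr !scalerA mulfV ?gt_eqF // mulrAC mulfV ?gt_eqF // scale1r mul1r.
  by rewrite -/b2 EB En Ew -/c; vec.
Qed.

End PodFrameExists.

(** * Devices and pea strings obtained from an adapted frame *)

Section PodFrameSuff.
Variable R : realType.
Implicit Types (S : device R) (e f u z : E3 R) (h l b : R).

Lemma onf_neq0 e f u : onf e f u -> [/\ e != 0, f != 0 & u != 0].
Proof.
case=> -[h1 h2 h3] _.
by split; apply: contra_eq_neq h1 + apply: contra_eq_neq h2 + apply: contra_eq_neq h3;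
  move=> ->; rewrite dot0l eq_sym oner_neq0.
Qed.

Lemma pod_frame_is_pod S e f u h l : pod_frame S e f u h l -> is_pod S.
Proof.
move=> F; have on := pf_on F; have [e0 f0 u0] := onf_neq0 on.
have h0 := pf_h F; have l0 := pf_l F; have r0 := pf_r F; have rhl := pf_rhl F.
set c := pod_center S in F *.
have circ b : `|b| = l -> principal_circle S (pt c e f h b).
  move=> bl; split; first by apply/(pf_planeP _ F); exists h, b.
  rewrite -/c {2}(pt0 c e f); apply/(dist_pt_eq _ _ _ _ _ on); first by rewrite ltW.
  by rewrite !subr0 -[b ^+ 2]real_normK ?num_real // bl rhl.
have line_z z : pod_axis S z <-> line_at c e z.
  rewrite (pf_axis F); split=> [[a ->]|[a _ <-]]; by exists a.
split.
- by exists c, u; split=> //; apply/seteqP; split=> z /(pf_plane F).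
- split.
    by exists c, e; split=> //; apply/seteqP; split=> z /line_z.
  move=> z /(pf_axis F)[a ->]; apply/(pf_planeP _ F); exists a, 0.
  by rewrite /pt scale0r addr0.
- split=> //; apply/(pf_axis F); exists 0; by rewrite scale0r addr0.
- rewrite (pf_end1 F) (pf_end2 F); split; try by apply: circ; rewrite ?normrN gtr0_norm.
  by apply/eqP => /(pt_inj on)[_]; lra.
- split.
    move=> z w /(pf_axis F)[a ->] /(pf_axis F)[a' ->].
    rewrite (pf_end1 F) (pf_end2 F) (_ : _ - _ = (a - a') *: e); last by vec.
    rewrite (_ : _ - _ = (2 * l) *: f); last by vec.
    by case: on => _ [H _ _]; rewrite !dot_lin H; ring.
  by rewrite -/c {1}(pt0 c e f) => /(pf_beam _ F)[b _ /(pt_inj on)[]]; lra.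
Qed.

(** The directrix is the parallel to the beam at height [pod_radius S + h]: a pea center at height
    [h + rho] is at distance [pod_radius S - rho] both from it and from the focus. *)
Lemma pod_frame_pea_string S e f u h l al : pod_frame S e f u h l ->
  pod_radius S + h = 2 * al ->
  is_pea_string S
    [set pt (pod_center S) e f (al - b ^+ 2 / (4 * al)) b | b in [set: R]].
Proof.
move=> F Eal; have on := pf_on F; have [e0 f0 u0] := onf_neq0 on.
have h0 := pf_h F; have l0 := pf_l F; have r0 := pf_r F; have rhl := pf_rhl F.
have al0 : 0 < al by lra.
set c := pod_center S in F *.
split.
  exists (line_at (pt c e f (2 * al) 0) f).
  have inD z : line_at (pt c e f (2 * al) 0) f z <-> exists b, z = pt c e f (2 * al) b.
    by split=> [[b _ <-]|[b ->]]; exists b => //; vec.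
  split.
  - by exists (pt c e f (2 * al) 0), f.
  - by move=> z /inD[b ->]; apply/(pf_planeP _ F); exists (2 * al), b.
  - by rewrite -/c {2}(pt0 c e f) => /inD[b /(pt_inj on)[]]; lra.
  - apply/seteqP; split=> z.
      move=> [b _ <-]; split; first by apply/(pf_planeP _ F); exists (al - b ^+ 2 / (4 * al)), b.
      exists (pt c e f (2 * al) b); split; first by apply/inD; exists b.
        rewrite -/c [X in _ = dist _ X](pt0 c e f) /dist /enorm; congr Num.sqrt.
        rewrite !(dist_pt _ _ _ _ _ on).
        by field; lra.
      move=> w' /inD[b' ->]; rewrite /dist enorm_le ?enorm_ge0 // enorm_sq.
      by rewrite !(dist_pt _ _ _ _ _ on); have := sqr_ge0 (b - b'); lra.
    move=> [/(pf_planeP _ F)[a [b Ez]] [w [/inD[b' Ew] H1 H2]]]; rewrite -/c in Ez.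
    (* Comparison with the foot of [z] on the directrix shows that the nearest point [w] is that
       foot. *)
    have /H2 : line_at (pt c e f (2 * al) 0) f (pt c e f (2 * al) b) by apply/inD; exists b.
    move: H1; rewrite -/c [X in _ = dist _ X](pt0 c e f) /dist Ew Ez.
    move=> /enormE; rewrite enorm_ge0 enorm_sq => /(_ isT).
    rewrite enorm_le ?enorm_ge0 // enorm_sq !(dist_pt _ _ _ _ _ on).
    move=> H3 H4.
    have [_ Eb] : 0 = 0 :> R /\ b - b' = 0 by apply: sqrD_le0; lra.
    exists b => //; congr (pt _ _ _ _ _).
    have E : b ^+ 2 = (al - a) * (4 * al) by rewrite Eb in H3; lra.
    by rewrite E mulfK; lra.
move=> x [rho /(pea_diskP _ _ F)[b _ [-> ->]]]; exists b => //; rewrite -/c.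
have El : l ^+ 2 = (2 * al - 2 * h) * (2 * al).
  by rewrite -Eal; have := rhl; lra.
by congr (pt _ _ _ _ _); rewrite Eal El; field; lra.
Qed.

End PodFrameSuff.

(** * The devices of a regular tetrahedron *)

Section Tetrahedron.
Variable R : realType.
Implicit Types (p q r s x y z : E3 R) (b t : R).

Definition tetra p q r s :=
  [/\ dist p q = 2, dist p r = 2 & dist p s = 2] /\
  [/\ dist q r = 2, dist q s = 2 & dist r s = 2].

(* [al] is the parameter alpha of the two confocal parabolas: the opposite edges
   are at distance [sqrt 2], which forces [al - 1 / (2 al) = sqrt 2]; moreover
   [kap = 1 / (4 al)]. *)
Definition sq2 : R := Num.sqrt 2.
Definition al : R := (2 + sq2) / 2.
Definition kap : R := (2 - sq2) / 4.
Definition prho b : R := kap * (1 - b ^+ 2).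
Definition mid p q : E3 R := 2^-1 *: (p + q).
Definition hdiff p q : E3 R := 2^-1 *: (p - q).
Definition axv p q r s : E3 R := sq2^-1 *: (mid p q - mid r s).
Definition ppt p q r s b : E3 R :=
  mid p q + prho b *: axv p q r s + b *: hdiff p q.

Lemma sq2_sq : sq2 * sq2 = 2.
Proof. by rewrite -expr2 sqr_sqrtr. Qed.

Lemma sq2_bounds : 7 / 5 < sq2 < 3 / 2.
Proof.
have := sq2_sq; have : 0 <= sq2 by apply: sqrtr_ge0.
by move=> h0 h; apply/andP; split; nra.
Qed.

Lemma sq2_neq0 : sq2 != 0.
Proof. by have /andP[] := sq2_bounds; lra. Qed.

Lemma tetra_swap p q r s : tetra p q r s -> tetra r s p q.
Proof. by case=> -[? ? ?] [? ? ?]; split; split=> //; rewrite distC. Qed.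

(** With [s] as origin, the three edge vectors have squared norm 4 and mutual products 2, which
    determines all products of the frame. *)
Lemma tetra_onf p q r s : tetra p q r s ->
  onf (axv p q r s) (hdiff p q) (hdiff r s).
Proof.
case=> -[/dist2_sq pq /dist2_sq pr /dist2_sq ps] [/dist2_sq qr /dist2_sq qs /dist2_sq rs].
have [a Ea] : exists a : E3 R, a = p - s by exists (p - s).
have [c Ec] : exists c : E3 R, c = q - s by exists (q - s).
have [d Ed] : exists d : E3 R, d = r - s by exists (r - s).
rewrite -Ea -Ec -Ed in ps qs rs.
rewrite (_ : p - q = a - c) in pq; last by rewrite Ea Ec; vec.
rewrite (_ : p - r = a - d) in pr; last by rewrite Ea Ed; vec.
rewrite (_ : q - r = c - d) in qr; last by rewrite Ec Ed; vec.
have [s2 _] := andP sq2_bounds; have s2s := sq2_sq.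
have -> : hdiff p q = 2^-1 *: (a - c) by rewrite Ea Ec; vec.
have -> : hdiff r s = 2^-1 *: d by rewrite Ed; vec.
have -> : axv p q r s = (2 * sq2)^-1 *: (a + c - d).
  by rewrite Ea Ec Ed /axv /mid; apply/rowP => i; rewrite !mxE; field; exact: sq2_neq0.
move: pq pr qr; rewrite !dot_lin ps qs rs (dotC c a) (dotC d a) (dotC d c) => pq pr qr.
have ac : dot a c = 2 by lra.
have ad : dot a d = 2 by lra.
have cd : dot c d = 2 by lra.
split; split; rewrite !dot_lin ?(dotC c a) ?(dotC d a) ?(dotC d c) ?ps ?qs ?rs ?ac ?ad ?cd;
  try by [field; exact: sq2_neq0|field; rewrite ?sq2_neq0].
rewrite [LHS](_ : _ = 2 / (sq2 * sq2)); last by field; exact: sq2_neq0.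
by rewrite s2s divff.
Qed.

Lemma mid_axv p q r s : mid p q = mid r s + sq2 *: axv p q r s.
Proof.
by rewrite /axv scalerA mulfV ?sq2_neq0 // scale1r addrC subrK.
Qed.

Lemma end1_half p q : p = mid p q + hdiff p q.
Proof. by rewrite /mid /hdiff; vec. Qed.

Lemma end2_half p q : q = mid p q - hdiff p q.
Proof. by rewrite /mid /hdiff; vec. Qed.

Lemma axvC p q r s : axv r s p q = - axv p q r s.
Proof. by rewrite /axv; vec. Qed.

(** Here [h = al - kap], the radius is [al + kap] and the half length is 1. These fit together since
    their sum is [2 al] and the difference of their squares is [4 al kap = 1]. *)
Definition pod_dev p q r s : device R :=
  Device (plane_at (mid p q) (hdiff r s)) (line_at (mid p q) (axv p q r s))
    (mid p q - (al - kap) *: axv p q r s) (al + kap) p q.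

Lemma pod_dev_frame p q r s : tetra p q r s ->
  pod_frame (pod_dev p q r s) (axv p q r s) (hdiff p q) (hdiff r s) (al - kap) 1.
Proof.
move=> T; have on := tetra_onf T; have [s2 s2'] := andP sq2_bounds.
have s2s := sq2_sq.
split=> //=.
- by rewrite /al /kap; lra.
- by rewrite /al /kap; lra.
- by rewrite /al /kap !expr2; lra.
- move=> z; rewrite /plane_at /=.
  set m := mid p q; set t := al - kap.
  rewrite (_ : z - (m - _) = (z - m) + t *: axv p q r s); last by vec.
  by case: on => _ [_ H _]; rewrite dotDr dotZr (dotC _ (axv _ _ _ _)) H mulr0 addr0.
- move=> z; set t := al - kap; split=> [[a _ <-]|[a ->]].
    by exists (a + t); vec.
  by exists (a - t) => //; vec.
- by rewrite /pt {1}(end1_half p q); vec.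
- by rewrite /pt {1}(end2_half p q); vec.
Qed.

Lemma pod_pair_dev p q r s : tetra p q r s ->
  pod_pair p q r s (pod_dev p q r s) (pod_dev r s p q).
Proof.
move=> T; have T' := tetra_swap T.
have F1 := pod_dev_frame T; have F2 := pod_dev_frame T'.
have [s2 s2'] := andP sq2_bounds; have s2s := sq2_sq.
have on := tetra_onf T; have [e0 f0 u0] := onf_neq0 on.
have Er : al + kap + (al - kap) = 2 * al by ring.
split=> //; split.
- by split; [apply: pod_frame_is_pod F1|apply: pod_frame_is_pod F2].
- rewrite /= axvC (mid_axv p q r s); apply/seteqP; split=> z [t _ <-].
    by exists (- (sq2 + t)) => //; vec.
  by exists (- (t + sq2)) => //; vec.
- exists (mid p q), (hdiff r s), (mid r s), (hdiff p q); split=> //.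
  by case: on => _ [_ _ H]; rewrite dotC.
- have P1 := pod_frame_pea_string F1 Er; have P2 := pod_frame_pea_string F2 Er.
  eexists; eexists; split; [exact: P1|exact: P2|].
  case: on => -[h1 h2 h3] [h12 h13 h23].
  (* The origin is the midpoint of the two foci, which are at distance [al] from each other. *)
  exists (mid p q - (al - kap) *: axv p q r s + (al / 2) *: axv p q r s).
  exists (hdiff p q), (hdiff r s), (- axv p q r s), al; split.
  + split; [by apply/enorm1P..| by apply/enorm1P; rewrite dotNl dotNr h1 opprK| by []|].
    by rewrite !dotNr !(dotC _ (axv _ _ _ _)) h12 h13 oppr0.
  + by rewrite /al; lra.
  + congr (image _ _); apply/funext => b; rewrite /pt /=.
    by set t := b ^+ 2 / _; set d := al - kap; vec.
  + congr (image _ _); apply/funext => b; rewrite /pt /= axvC (mid_axv p q r s).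
    set t := b ^+ 2 / _; rewrite /al /kap.
    by apply/rowP => i; rewrite !mxE; field; lra.
(* The bulb is the pea with [b = 0]; its radius is [1 / (4 al) = kap]. *)
- have a1 : al * kap * 4 = 1 by rewrite /al /kap; lra.
  have key : (1 ^+ 2 - 0 ^+ 2) / (2 * (al + kap + (al - kap))) = kap.
    have -> : 1 ^+ 2 - 0 ^+ 2 = (al * kap * 4) :> R by rewrite a1; ring.
    by field; rewrite /al; lra.
  split; split.
  + apply/(pf_axis F2); exists al.
    by rewrite /= axvC (mid_axv p q r s) /al /kap; vec.
  + exists kap; apply/(pea_diskP _ _ F2); exists 0; rewrite ?normr0 //; split=> //.
    by rewrite /pt /= axvC (mid_axv p q r s) /al /kap; vec.
  + apply/(pf_axis F1); exists al.
    by rewrite /= axvC (mid_axv p q r s) /al /kap; vec.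
  + exists kap; apply/(pea_diskP _ _ F1); exists 0; rewrite ?normr0 //; split=> //.
    by rewrite /pt /= axvC (mid_axv p q r s) /al /kap; vec.
Qed.

End Tetrahedron.

(** * Uniqueness of the convex confocal pair over two opposite edges *)

Section PodPair.
Variable R : realType.
Implicit Types (p q r s x y z e f u v : E3 R) (a b t h : R).

(** Each difference of endpoints is a multiple of the other with a factor in [[-1, 1]]. The two
    factors have product 1, so both are 1 or both are -1. *)
Lemma segment_endpoints p q p' q' : segment p q = segment p' q' ->
  (p = p' /\ q = q') \/ (p = q' /\ q = p').
Proof.
move=> E.
have seg0 x y : segment x y x.
  by exists 0; [rewrite /= lexx ler01|rewrite scale0r addr0].
have seg1 x y : segment x y y.
  by exists 1; [rewrite /= lexx ler01|rewrite scale1r addrC subrK].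
have /= : segment p' q' p by rewrite -E.
have /= : segment p' q' q by rewrite -E.
have /= : segment p q p' by rewrite E.
have /= : segment p q q' by rewrite E.
move=> [s' /= s'1 Es'] [s /= s1 Es] [t' /= t'1 Et'] [t /= t1 Et].
have [/eqP|D0] := eqVneq (q' - p') 0.
  rewrite subr_eq0 => /eqP Eqp; move: Et Et'.
  by rewrite Eqp subrr !scaler0 !addr0 => -> ->; left.
have Eq : q - p = (t' - t) *: (q' - p') by rewrite -Et -Et'; vec.
have Eq' : q' - p' = (s' - s) *: (q - p) by rewrite -Es -Es'; vec.
have : (s' - s) * (t' - t) = 1.
  apply/eqP; rewrite -subr_eq0.
  have /eqP : ((s' - s) * (t' - t) - 1) *: (q' - p') = 0.
    by rewrite scalerBl -scalerA -Eq -Eq' scale1r subrr.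
  by rewrite scaler_eq0 (negbTE D0) orbF.
move=> H.
have [[E0 E1]|[E0 E1]] : (t = 0 /\ t' = 1) \/ (t = 1 /\ t' = 0).
  clear -s1 s'1 t1 t'1 H; move/andP: s1 => [? ?]; move/andP: s'1 => [? ?].
  move/andP: t1 => [? ?]; move/andP: t'1 => [? ?].
  by case: (leP s s') => ss; [left|right]; split; nra.
- by left; rewrite -Et -Et' E0 E1 scale0r addr0 scale1r addrC subrK.
- by right; rewrite -Et -Et' E0 E1 scale0r addr0 scale1r addrC subrK.
Qed.

Lemma pod_pair_sym p q r s (S1 S2 : device R) :
  pod_pair p q r s S1 S2 -> pod_pair r s p q S2 S1.
Proof.
case=> -[[i1 i2] EL [p1 [u1 [p2 [u2 [n1 n2 E1 E2 d12]]]]]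
  [P1 [P2 [H1 H2 [ o [e1 [e2 [e3 [alpha [on a0 EP1 EP2]]]]]]]]] [b1 b2]] Bm1 Bm2.
split=> //; split=> //.
- by exists p2, u2, p1, u1; split=> //; rewrite dotC.
- exists P2, P1; split=> //; exists o, e2, e1, (- e3), alpha; split=> //.
  + case: on => h1 h2 h3 h12 [h13 h23].
    by split; rewrite ?enormN ?(dotC e2 e1) ?dotNr ?h13 ?h23 ?oppr0.
  + rewrite EP2; congr (image _ _); apply/funext => b.
    by set t := b ^+ 2 / _; vec.
  + rewrite EP1; congr (image _ _); apply/funext => b.
    by set t := b ^+ 2 / _; vec.
Qed.

(** [A] is the distance between the two centers and [N = h1 + h2 - A] the signed distance between
    the midpoints of the beams. The equations give [h1 = h2 = A - 1 / (4 A)], so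
    [N = A - 1 / (2 A)]. The root for [N = - sq2] has [A < 1 / 2], which contradicts [0 < h1]. *)
Lemma pod_pair_scalars (h1 r1 h2 r2 A : R) : 0 < h1 -> 0 < h2 -> 0 < r1 ->
  r1 ^+ 2 = h1 ^+ 2 + 1 -> r2 ^+ 2 = h2 ^+ 2 + 1 ->
  r1 + h1 = 2 * A -> r2 + h2 = 2 * A -> (h1 + h2 - A) ^+ 2 = 2 ->
  A = al R /\ h1 + h2 - A = sq2 R.
Proof.
move=> h10 h20 r10 E1 E2 A1 A2 H.
have /andP[s1 s2] := sq2_bounds R; have ss := sq2_sq R.
have X1 : 4 * A * h1 = 4 * A ^+ 2 - 1.
  by have := E1; rewrite (_ : r1 = 2 * A - h1); [lra|lra].
have X2 : 4 * A * h2 = 4 * A ^+ 2 - 1.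
  by have := E2; rewrite (_ : r2 = 2 * A - h2); [lra|lra].
have A0 : 0 < A by lra.
have A14 : 1 / 4 < A ^+ 2 by have := mulr_gt0 A0 h10; lra.
pose N := h1 + h2 - A; rewrite -/N in H *.
have XN : 2 * A * N = 2 * A ^+ 2 - 1 by rewrite /N; lra.
have [N0|N0] := leP 0 N.
  have EN : N = sq2 R.
    by apply/eqP; rewrite -(@eqrXn2 _ 2) ?sqrtr_ge0 // H expr2 ss.
  split=> //; rewrite EN in XN; rewrite /al.
  have : (A - (2 + sq2 R) / 2) * (A - (sq2 R - 2) / 2) = 0 by nra.
  by move/eqP; rewrite mulf_eq0 => /orP[]/eqP; lra.
have EN : - N = sq2 R.
  by apply/eqP; rewrite -(@eqrXn2 _ 2) ?sqrtr_ge0 ?sqrrN ?H ?expr2 ?ss //; lra.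
exfalso; have : A > 1 / 2 by nra.
by nra.
Qed.

(** In an adapted frame, the bulb center is at distance [(pod_radius S + h) / 2] from the center of
    the device. As the center of each device is the bulb center of the other, both have the same
    [pod_radius S + h] and opposite axis directions. The distance [sq2] between the midpoints of the
    beams then fixes every scalar. *)
Lemma pod_pair_pea_disk p q r s (S1 S2 : device R) : tetra p q r s ->
  pod_pair p q r s S1 S2 -> forall x rho,
  pea_disk S1 x rho <->
  exists2 b, `|b| <= 1 & rho = prho b /\ x = ppt p q r s b.
Proof.
move=> T [[[i1 i2] _ _ _ [[bx1 [rho2 bd2]] [bx2 [rho1 bd1]]]] B1 B2].
have [e1 [f1 [u1 [h1 [l1 F1]]]]] := is_pod_frame i1.
have [e2 [f2 [u2 [h2 [l2 F2]]]]] := is_pod_frame i2.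
have ends x y (S : device R) e f u h l : pod_frame S e f u h l ->
    beam S = segment x y -> dist x y = 2 -> l = 1 /\
    mid x y = pod_center S + h *: e /\ (f = hdiff x y \/ f = - hdiff x y).
  move=> F /segment_endpoints; rewrite (pf_end1 F) (pf_end2 F) => Ends d2.
  have l0 := pf_l F; case: (pf_on F) => -[_ ff _] _.
  have Exy : x - y = (2 * l) *: f \/ x - y = - ((2 * l) *: f).
    by case: Ends => -[<- <-]; [left|right]; vec.
  have Hl : l = 1.
    move: d2 => /dist2_sq.
    by case: Exy => ->; rewrite ?dotNl ?dotNr ?opprK dotZl dotZr ff; nra.
  split=> //; split; first by case: Ends => -[<- <-]; rewrite /mid /pt; vec.
  by rewrite /hdiff; case: Exy => ->; rewrite Hl; [left|right]; vec.
have dpq : dist p q = 2 by case: T => -[].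
have drs : dist r s = 2 by case: T => _ [].
have [El1 [Em1 Ef1]] := ends _ _ _ _ _ _ _ _ F1 B1 dpq.
have [El2 [Em2 Ef2]] := ends _ _ _ _ _ _ _ _ F2 B2 drs.
rewrite El1 in F1; rewrite El2 in F2; clear B1 B2 ends.
set c1 := pod_center S1 in bx1 bd1 bx2 bd2 F1 Em1.
set c2 := pod_center S2 in bx1 bd1 bx2 bd2 F2 Em2.
have h10 := pf_h F1; have h20 := pf_h F2.
have r10 := pf_r F1; have r20 := pf_r F2.
have rhl1 := pf_rhl F1; have rhl2 := pf_rhl F2.
have bulb (S : device R) e f u h z rho : pod_frame S e f u h 1 ->
    pod_axis S z -> pea_disk S z rho ->
    z = pod_center S + ((pod_radius S + h) / 2) *: e.
  move=> F /(pf_axis F)[a ->] /(pea_diskP _ _ F)[b _ [-> ]].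
  have -> : pod_center S + a *: e = pt (pod_center S) e f a 0.
    by rewrite /pt scale0r addr0.
  move=> /(pt_inj (pf_on F))[-> <-]; rewrite /pt scale0r addr0.
  have rh : 1 = (pod_radius S - h) * (pod_radius S + h) by have := pf_rhl F; lra.
  rewrite expr1n expr0n /= subr0 [X in X / _]rh.
  have := pf_r F; have := pf_h F => *.
  by congr (_ + _ *: _); field; lra.
have Ec2 := bulb _ _ _ _ _ _ _ F1 bx2 bd1.
have Ec1 := bulb _ _ _ _ _ _ _ F2 bx1 bd2.
rewrite -/c1 -/c2 in Ec1 Ec2.
set A1 := _ / 2 in Ec2; set A2 := _ / 2 in Ec1.
have A10 : 0 < A1 by rewrite /A1; lra.
have A20 : 0 < A2 by rewrite /A2; lra.
have EA : A1 *: e1 = - (A2 *: e2).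
  have -> : A1 *: e1 = c2 - c1 by rewrite Ec2; vec.
  have -> : A2 *: e2 = c1 - c2 by rewrite {1}Ec1; vec.
  by rewrite opprB.
case: (pf_on F1) => -[ee1 _ _] _; case: (pf_on F2) => -[ee2 _ _] _.
have EAA : A1 = A2.
  have : dot (A1 *: e1) (A1 *: e1) = dot (A2 *: e2) (A2 *: e2).
    by rewrite EA dotNl dotNr opprK.
  rewrite !dotZl !dotZr ee1 ee2 !mulr1 -!expr2 => /eqP.
  by rewrite eqrXn2 ?(ltW A10) ?(ltW A20) // => /eqP.
have Em12 : mid p q - mid r s = (h1 + h2 - A1) *: e1.
  have Ee2 : e2 = - e1.
    apply: (scalerI (lt0r_neq0 A20)); rewrite scalerN -EAA EA EAA opprK //.
  by rewrite Em1 Em2 Ec2 Ee2; vec.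
have on := tetra_onf T; case: (on) => -[aa _ _] _.
have N2 : (h1 + h2 - A1) ^+ 2 = 2.
  have := congr1 (fun z => dot z z) Em12.
  rewrite /= dotZl dotZr ee1 mulr1 -expr2 => <-.
  rewrite (mid_axv p q r s) addrC addKr dotZl dotZr aa.
  by rewrite mulr1 sq2_sq.
rewrite expr1n in rhl1 rhl2.
have [EAl EN] : A1 = al R /\ h1 + h2 - A1 = sq2 R.
  apply: (pod_pair_scalars h10 h20 r10 rhl1 rhl2 _ _ N2).
    by rewrite /A1; lra.
  by rewrite EAA /A2; lra.
have Ee : e1 = axv p q r s by rewrite /axv Em12 EN scalerA mulVf ?sq2_neq0 // scale1r.
have Er : 2 * (pod_radius S1 + h1) = (kap R)^-1.
  have [s1 s2] := andP (sq2_bounds R); have ss := sq2_sq R.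
  have k0 : kap R != 0 by rewrite /kap; lra.
  apply: (mulIf k0); rewrite mulVf // (_ : _ + _ = 2 * al R); last by rewrite -EAl /A1; lra.
  by rewrite /al /kap; lra.
have Eprho b : (1 ^+ 2 - b ^+ 2) / (2 * (pod_radius S1 + h1)) = prho b.
  by rewrite Er invrK expr1n mulrC.
have Ept b rho : pt c1 e1 f1 (h1 + rho) b = mid p q + rho *: axv p q r s + b *: f1.
  by rewrite Em1 Ee /pt; vec.
have prhoN b : prho (- b) = prho b by rewrite /prho sqrrN.
(* The naming of the beam ends leaves the sign of [f1] open; the substitution of [- b] for [b]
   absorbs it. *)
move=> x rho; rewrite (pea_diskP x rho F1); case: Ef1 => Ef.
  split=> -[b b1 [Erho ->]]; exists b => //; split=> //.
  - by rewrite Erho.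
  - by rewrite Ept Erho Eprho Ef.
  - by rewrite Eprho.
  - by rewrite Ept Erho Ef.
split=> -[b b1 [Erho ->]]; exists (- b); rewrite ?normrN //; split=> //.
- by rewrite Erho prhoN.
- by rewrite Ept Erho Eprho Ef /ppt prhoN scalerN scaleNr.
- by rewrite Eprho prhoN.
- by rewrite Ept Erho Ef /ppt scaleNr scalerN opprK.
Qed.

End PodPair.

(** * Wedge points *)

Section Wedge.
Variable R : realType.
Implicit Types (p q r s x y z N : E3 R) (b t : R).

Notation al := (al R).
Notation kap := (kap R).

Lemma al_kap : 4 * (al * kap) = 1.
Proof. by have := sq2_sq R; rewrite /al /kap; lra. Qed.

Lemma al_gt0 : 0 < al.
Proof. by have /andP[] := sq2_bounds R; rewrite /al; lra. Qed.

Lemma kap_gt0 : 0 < kap.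
Proof. by have /andP[] := sq2_bounds R; rewrite /kap; lra. Qed.

Lemma al_2kap : al + 2 * kap = 2.
Proof. by rewrite /al /kap; lra. Qed.

(** This is the distance between the pea centers with parameters [b] and [t] of the two devices, and
    [wvec] is their difference. The distance splits into a function of [b] plus a function of [t],
    the focal property of confocal parabolas. *)
Definition wdist b t : R := al + kap * (b ^+ 2 + t ^+ 2).
Definition wvec p q r s b t : E3 R :=
  (al - kap * (b ^+ 2 + t ^+ 2)) *: axv p q r s + b *: hdiff p q - t *: hdiff r s.
Definition wpt p q r s b t : E3 R :=
  phi (ppt p q r s b) (prho b) (ppt r s p q t).

Lemma wdist_gt0 b t : 0 < wdist b t.
Proof.
by rewrite ltr_wpDr ?al_gt0 // mulr_ge0 ?(ltW kap_gt0) // addr_ge0 ?sqr_ge0.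
Qed.

Lemma wdist_neq0 b t : wdist b t != 0.
Proof. by rewrite gt_eqF ?wdist_gt0. Qed.

Lemma wdistC b t : wdist b t = wdist t b.
Proof. by rewrite /wdist [b ^+ 2 + _]addrC. Qed.

Lemma wvecC p q r s b t : wvec r s p q t b = - wvec p q r s b t.
Proof. by rewrite /wvec axvC [t ^+ 2 + _]addrC; set a := al - _; vec. Qed.

Lemma ppt_sub p q r s b t : ppt p q r s b - ppt r s p q t = wvec p q r s b t.
Proof.
rewrite /ppt /wvec axvC (mid_axv p q r s) /prho.
have -> : al = sq2 R + 2 * kap by rewrite /al /kap; lra.
by vec.
Qed.

Lemma wvec_sq p q r s b t : tetra p q r s ->
  dot (wvec p q r s b t) (wvec p q r s b t) = wdist b t ^+ 2.
Proof.
move=> /tetra_onf[[h1 h2 h3] [h12 h13 h23]]; rewrite /wvec.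
set e := axv p q r s in h1 h12 h13 *; set f := hdiff p q in h2 h12 h23 *.
set u := hdiff r s in h3 h13 h23 *; clearbody e f u.
rewrite !dot_lin (dotC f e) (dotC u e) (dotC u f) h1 h2 h3 h12 h13 h23 /wdist.
set w := b ^+ 2 + t ^+ 2.
have -> : (al + kap * w) ^+ 2 = (al - kap * w) ^+ 2 + 4 * (al * kap) * w by ring.
by rewrite al_kap /w; ring.
Qed.

Lemma dist_ppt p q r s b t : tetra p q r s ->
  dist (ppt p q r s b) (ppt r s p q t) = wdist b t.
Proof.
move=> T; rewrite /dist; apply/enormE; first exact: ltW (wdist_gt0 _ _).
by rewrite ppt_sub wvec_sq.
Qed.

Lemma wptE p q r s b t : tetra p q r s ->
  wpt p q r s b t = ppt p q r s b + (prho b / wdist b t) *: wvec p q r s b t.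
Proof. by move=> T; rewrite /wpt /phi dist_ppt // ppt_sub. Qed.

(* The wedge is also a family of curves on the spheres around the opposite pea
   string: the distance of the point to [ppt r s p q t] does not depend on [b]. *)
Lemma wptE2 p q r s b t : tetra p q r s ->
  wpt p q r s b t = ppt r s p q t +
    ((al + kap + kap * t ^+ 2) / wdist b t) *: wvec p q r s b t.
Proof.
move=> T; rewrite wptE // -{1}[ppt p q r s b](subrK (ppt r s p q t)) ppt_sub.
have -> : al + kap + kap * t ^+ 2 = wdist b t + prho b by rewrite /wdist /prho; ring.
by rewrite mulrDl mulfV ?wdist_neq0 // scalerDl scale1r [wvec _ _ _ _ _ _ + _]addrC -addrA.
Qed.

(** The segment between the two wedge points runs through both pea centers, so its length is [prho b
    + wdist b t + prho t = al + 2 kap = 2]. *)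
Lemma wpt_opp p q r s b t : tetra p q r s ->
  wpt p q r s b t - wpt r s p q t b = (2 / wdist b t) *: wvec p q r s b t.
Proof.
move=> T; have T2 := tetra_swap T; rewrite wptE2 // wptE // wvecC (wdistC t).
have -> : 2 / wdist b t = (al + kap + kap * t ^+ 2) / wdist b t + prho t / wdist b t.
  by rewrite -mulrDl -al_2kap /prho; congr (_ / _); ring.
by set a := (_ + _) / _; set c := prho t / _; vec.
Qed.

Lemma dist_wpt_opp p q r s b t : tetra p q r s ->
  dist (wpt p q r s b t) (wpt r s p q t b) = 2.
Proof.
move=> T; apply/enormE => //; rewrite wpt_opp // dotZl dotZr wvec_sq //.
by field; rewrite wdist_neq0.
Qed.

Lemma ppt1 p q r s : ppt p q r s 1 = p.
Proof.
by rewrite /ppt /prho expr1n subrr mulr0 scale0r addr0 scale1r -end1_half.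
Qed.

Lemma pptN1 p q r s : ppt p q r s (- 1) = q.
Proof.
by rewrite /ppt /prho sqrrN expr1n subrr mulr0 scale0r addr0 scaleN1r -end2_half.
Qed.

Lemma prho1 b : b = 1 \/ b = - 1 -> prho b = 0.
Proof. by case=> ->; rewrite /prho ?sqrrN expr1n subrr mulr0. Qed.

Lemma wpt_ext p q r s b t : b = 1 \/ b = - 1 -> wpt p q r s b t = ppt p q r s b.
Proof. by move=> /prho1 H; rewrite /wpt /phi H mul0r scale0r addr0. Qed.

Lemma dist_wpt_ppt p q r s b t : tetra p q r s ->
  dist (wpt p q r s b t) (ppt r s p q t) = al + kap + kap * t ^+ 2.
Proof.
move=> T; have := al_gt0; have := kap_gt0; have := sqr_ge0 t => t2 k0 a0.
have k2 : 0 <= kap * t ^+ 2 by rewrite mulr_ge0 // ltW.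
apply/enormE; first lra.
rewrite wptE2 // [X in dot X X](_ : _ = ((al + kap + kap * t ^+ 2) / wdist b t) *: wvec p q r s b t).
  by rewrite dotZl dotZr wvec_sq //; field; rewrite wdist_neq0.
by rewrite addrC addKr.
Qed.

Lemma dist_wpt_end p q r s b t : tetra p q r s -> t = 1 \/ t = - 1 ->
  dist (wpt p q r s b t) (ppt r s p q t) = 2.
Proof.
move=> T Ht; rewrite dist_wpt_ppt // -al_2kap.
by case: Ht => ->; rewrite ?sqrrN expr1n; ring.
Qed.

(** First order condition at an interior maximum, free of derivatives: for small [h] of either sign
    the term [h * a] dominates. *)
Lemma linear_coef_eq0 (a c d : R) : 0 < d ->
  (forall h, `|h| <= d -> h * (a + c * h) <= 0) -> a = 0.
Proof.
move=> d0.
have pos a' c' : (forall h, `|h| <= d -> h * (a' + c' * h) <= 0) -> a' <= 0.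
  move=> H; rewrite leNgt; apply/negP => a0.
  have c1 : 0 < `|c'| + 1 by rewrite ltr_wpDl.
  pose D := a' + d * (`|c'| + 1).
  have D0 : 0 < D by rewrite addr_gt0 // mulr_gt0.
  (* This [h] is at most [d] and small enough for [a' + c' * h] to stay positive. *)
  pose h := d * a' / D.
  have h0 : 0 < h by rewrite divr_gt0 // mulr_gt0.
  have hd : h <= d by rewrite ler_pdivrMr // ler_pM2l // /D lerDl mulr_ge0 // ltW.
  have hc : `|c'| * h < a'.
    rewrite /h mulrA ltr_pdivrMr // /D.
    have := normr_ge0 c'; set n := `|c'|; move=> n0.
    have : 0 < a' * d by rewrite mulr_gt0.
    have : 0 < a' * a' by rewrite mulr_gt0.
    lra.
  have : a' + c' * h <= 0.
    by rewrite -(pmulr_rle0 _ h0); apply: H; rewrite gtr0_norm.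
  have : - `|c'| * h <= c' * h by rewrite ler_wpM2r ?(ltW h0) // lerNl ler_normr lexx orbT.
  lra.
move=> H; apply/eqP; rewrite eq_le (pos a c) //=.
rewrite -oppr_le0; apply: (pos (- a) c) => h hd.
have := H (- h); rewrite normrN => /(_ hd).
by lra.
Qed.

(** The conclusion is the vanishing of the numerator of the derivative of the quotient at [t0]; it
    comes from clearing denominators at [t0 + h]. *)
Lemma quad_ratio_crit (A B C E F t0 : R) : 0 < E -> 0 < F -> `|t0| < 1 ->
  (forall t, `|t| <= 1 ->
     (A + B * t + C * t ^+ 2) / (E + F * t ^+ 2) <=
     (A + B * t0 + C * t0 ^+ 2) / (E + F * t0 ^+ 2)) ->
  (B + 2 * C * t0) * (E + F * t0 ^+ 2) = 2 * F * t0 * (A + B * t0 + C * t0 ^+ 2).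
Proof.
move=> E0 F0 t01 H; apply/eqP; rewrite -subr_eq0; apply/eqP.
have D t : 0 < E + F * t ^+ 2 by rewrite ltr_wpDr // mulr_ge0 ?sqr_ge0 // ltW.
apply: (@linear_coef_eq0 _ (C * (E + F * t0 ^+ 2) - F * (A + B * t0 + C * t0 ^+ 2))
  (1 - `|t0|)); first by rewrite subr_gt0.
move=> h hd.
have /H : `|t0 + h| <= 1 by rewrite (le_trans (ler_normD _ _)) //; lra.
by rewrite ler_pdivrMr ?D // mulrAC ler_pdivlMr ?D //; lra.
Qed.

(* Up to the positive factors [prho b] and the radius of [wptE2], moving [t] or
   [b] alone changes the height [dot N (wpt ..)] by the change of
   [dot N (wvec b t) / wdist b t], which must therefore be critical in both
   parameters; [wvec / wdist] is an inverse stereographic projection. *)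
Lemma wedge_normal p q r s b t N : tetra p q r s -> `|b| < 1 -> `|t| < 1 ->
  (forall b' t', `|b'| <= 1 -> `|t'| <= 1 ->
     dot N (wpt p q r s b' t' - wpt p q r s b t) <= 0) ->
  exists c, N = c *: wvec p q r s b t.
Proof.
move=> T b1 t1 H; have k0 := kap_gt0; have a0 := al_gt0.
have on := tetra_onf T; have EN := onf_expand on N.
set U3 := dot N (axv p q r s) in EN; set U1 := dot N (hdiff p q) in EN.
set U2 := dot N (hdiff r s) in EN.
have dw b' t' : dot N (wvec p q r s b' t') =
    U3 * (al - kap * (b' ^+ 2 + t' ^+ 2)) + U1 * b' - U2 * t'.
  by rewrite /wvec dotDr dotDr dotNr (dotZr _ (axv p q r s)) (dotZr _ (hdiff p q)) (dotZr _ (hdiff r s)) /U1 /U2 /U3; ring.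
have pb : 0 < prho b.
  rewrite /prho mulr_gt0 // subr_gt0 -[b ^+ 2]real_normK ?num_real //.
  by rewrite expr_lt1.
have divAC (x y z : R) : x / y * z = x * (z / y) :> R by rewrite mulrAC mulrA.
have Ht t' : `|t'| <= 1 -> dot N (wvec p q r s b t') / wdist b t' <=
    dot N (wvec p q r s b t) / wdist b t.
  move=> t'1; have := H b t' (ltW b1) t'1.
  rewrite !wptE // opprD addrACA subrr add0r -!scalerN.
  rewrite dotDr !dotZr dotNr mulrN subr_le0 !divAC.
  by rewrite ler_pM2l.
pose Rt := al + kap + kap * t ^+ 2.
have Rt0 : 0 < Rt by rewrite /Rt ltr_wpDr ?addr_gt0 // mulr_ge0 ?sqr_ge0 // ltW.
have Hb b' : `|b'| <= 1 -> dot N (wvec p q r s b' t) / wdist b' t <=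
    dot N (wvec p q r s b t) / wdist b t.
  move=> b'1; have := H b' t b'1 (ltW t1).
  rewrite !wptE2 // opprD addrACA subrr add0r -!scalerN -/Rt.
  rewrite dotDr !dotZr dotNr mulrN subr_le0 !divAC.
  by rewrite ler_pM2l.
have E1 : (U1 - 2 * kap * U3 * b) * wdist b t =
    2 * kap * b * dot N (wvec p q r s b t).
  have := @quad_ratio_crit (U3 * (al - kap * t ^+ 2) - U2 * t) U1 (- kap * U3)
    (al + kap * t ^+ 2) kap b.
  rewrite dw /wdist => HH.
  have -> : al + kap * (b ^+ 2 + t ^+ 2) = al + kap * t ^+ 2 + kap * b ^+ 2 by ring.
  have -> : U1 - 2 * kap * U3 * b = U1 + 2 * (- kap * U3) * b by ring.
  rewrite HH //; first by ring.
    by rewrite ltr_wpDr // mulr_ge0 ?sqr_ge0 // ltW.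
  move=> b' /Hb; rewrite !dw /wdist.
  by congr (_ / _ <= _ / _); ring.
have E2 : (- U2 - 2 * kap * U3 * t) * wdist b t =
    2 * kap * t * dot N (wvec p q r s b t).
  have := @quad_ratio_crit (U3 * (al - kap * b ^+ 2) + U1 * b) (- U2) (- kap * U3)
    (al + kap * b ^+ 2) kap t.
  rewrite dw /wdist => HH.
  have -> : al + kap * (b ^+ 2 + t ^+ 2) = al + kap * b ^+ 2 + kap * t ^+ 2 by ring.
  have -> : - U2 - 2 * kap * U3 * t = - U2 + 2 * (- kap * U3) * t by ring.
  rewrite HH //; first by ring.
    by rewrite ltr_wpDr // mulr_ge0 ?sqr_ge0 // ltW.
  move=> t' /Ht; rewrite !dw /wdist.
  by congr (_ / _ <= _ / _); ring.
have D0 := wdist_neq0 b t.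
set D := wdist b t in E1 E2 D0.
set n := dot N (wvec p q r s b t) in E1 E2.
have En : n = U3 * (al - kap * (b ^+ 2 + t ^+ 2)) + U1 * b - U2 * t by exact: dw.
pose c := 2 * kap * (U3 * D + n) / D.
have F1 : U1 = c * b.
  by apply: (mulIf D0); rewrite /c mulrAC divfK //; lra.
have F2 : U2 = - (c * t).
  by apply: (mulIf D0); rewrite /c mulNr mulrAC divfK //; lra.
(* The third coordinate has the same factor [c] thanks to [4 * (al * kap) = 1]. *)
have F3 : U3 = (al - kap * (b ^+ 2 + t ^+ 2)) * c.
  apply: (mulIf D0); rewrite -[RHS]mulrA /c divfK //.
  have G1 : U1 * D = 2 * kap * b * (U3 * D + n) by lra.
  have G2 : U2 * D = - (2 * kap * t * (U3 * D + n)) by lra.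
  have G3 : n * D = U3 * (al - kap * (b ^+ 2 + t ^+ 2)) * D
       + 2 * kap * (b ^+ 2 + t ^+ 2) * (U3 * D + n).
    rewrite {1}En mulrBl mulrDl [U1 * b * D]mulrAC G1 [U2 * t * D]mulrAC G2; ring.
  have ED : D = al + kap * (b ^+ 2 + t ^+ 2) by [].
  have AK := al_kap.
  clearbody n D U1 U2 U3 c.
  set w := b ^+ 2 + t ^+ 2 in G3 ED *.
  have G4 : (U3 * D + n) * (al - kap * w) = 2 * al * U3 * D.
    have Em : al - kap * w = D - 2 * kap * w by rewrite ED; ring.
    have E2al : 2 * al = D + (al - kap * w) by rewrite ED; ring.
    rewrite E2al {1}Em mulrBr [LHS](_ : _ = U3 * D * D + n * D - 2 * kap * w * (U3 * D + n)); last by ring.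
    by rewrite G3; ring.
  have -> : (al - kap * w) * (2 * kap * (U3 * D + n)) =
     2 * kap * ((U3 * D + n) * (al - kap * w)) by ring.
  by rewrite G4 -[LHS]mul1r -[X in X * _ = _]AK; ring.
exists c; rewrite EN F1 F2 F3 /wvec; set a := al - _; vec.
Qed.

End Wedge.

(** * Bodies of constant width 2 *)

Section ConstantWidth.
Variable R : realType.
Implicit Types (x y z u w : E3 R) (K A : set (E3 R)) (t : R).

Lemma continuous_coord i (a c : R) : continuous (fun x : E3 R => a + c * x 0 i).
Proof.
move=> x; apply: (@continuousD R R^o (E3 R) (cst a) (fun x : E3 R => c * x 0 i)).
  exact: cst_continuous.
by apply: continuousM; [exact: cst_continuous|apply: coord_continuous].
Qed.

Lemma continuous_sum3 (f : 'I_3 -> E3 R -> R) :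
  (forall i, continuous (f i)) -> continuous (fun x => f 0 x + f 1 x + f 2%:R x).
Proof.
move=> H x; apply: (@continuousD R R^o (E3 R) (fun x => f 0 x + f 1 x) (f 2%:R)); last exact: H.
by apply: (@continuousD R R^o (E3 R) (f 0) (f 1)); exact: H.
Qed.

Lemma dot_continuous (u : E3 R) : continuous (dot u).
Proof.
rewrite (_ : dot u = fun x => (0 + u 0 0 * x 0 0) + (0 + u 0 1 * x 0 1) + (0 + u 0 2%:R * x 0 2%:R)); last first.
  by apply/funext => x; rewrite !add0r; exact: dotE.
apply: (@continuous_sum3 (fun i x => 0 + u 0 i * x 0 i)) => i; exact: continuous_coord.
Qed.

Lemma dot_sub_continuous  (z : E3 R) : continuous (fun y : E3 R => dot (z - y) (z - y)).
Proof.
rewrite (_ : (fun y : E3 R => _) = fun x : E3 R => (z 0 0 + -1 * x 0 0) * (z 0 0 + -1 * x 0 0) +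
    (z 0 1 + -1 * x 0 1) * (z 0 1 + -1 * x 0 1) + (z 0 2%:R + -1 * x 0 2%:R) * (z 0 2%:R + -1 * x 0 2%:R)); last first.
  by apply/funext => x; rewrite dotE !mxE !mulN1r.
apply: (@continuous_sum3 (fun i x => (z 0 i + -1 * x 0 i) * (z 0 i + -1 * x 0 i))) => i x.
have H := @continuous_coord i (z 0 i) (-1).
by apply: (@continuousM R (E3 R) (fun x : E3 R => z 0 i + -1 * x 0 i) (fun x : E3 R => z 0 i + -1 * x 0 i)); exact: H.
Qed.

Lemma compact_dot_max K u : compact K -> K !=set0 ->
  exists2 x, K x & forall z, K z -> dot u z <= dot u x.
Proof.
move=> cK K0; have [x Kx H] := EVT_max_rV K0 cK (continuous_subspaceT (@dot_continuous u)).
by exists x; [exact/set_mem|move=> z Kz; apply: H; exact/mem_set].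
Qed.

Lemma interior_line A x w : interior A x ->
  exists2 e : R, 0 < e & forall t, `|t| < e -> A (x + t *: w).
Proof.
move=> /nbhs_ballP[e /= e0 He].
have w1 : 0 < `|w| + 1 by rewrite ltr_wpDl.
exists (e / (`|w| + 1)) => [|t]; first by rewrite divr_gt0.
rewrite ltr_pdivlMr // => H; apply: He; rewrite -ball_normE /=.
rewrite opprD addrA subrr add0r normrN normrZ; apply: le_lt_trans H.
by rewrite ler_wpM2l // lerDl.
Qed.

Lemma compact_boundary_sub K : compact K -> boundary K `<=` K.
Proof.
move=> cK x [clx _]; have : closed K by apply: compact_closed => //; exact: norm_hausdorff.
by move=> /closure_id ->.
Qed.

Section Body.
Variable K : set (E3 R).
Hypotheses (bK : convex_body K) (wK : constant_width K 2).

Let K0 : K !=set0.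
Proof. by case: bK => _ _ [x /interior_subset]; exists x. Qed.

Let cK : compact K.
Proof. by case: bK. Qed.

Lemma width_attained u : enorm u = 1 -> exists x z,
  [/\ K x, K z, forall y, K y -> dot u z <= dot u y <= dot u x & dot u (x - z) = 2].
Proof.
move=> u1; have [x Kx Hx] := compact_dot_max u cK K0.
have [z Kz Hz'] := compact_dot_max (- u) cK K0.
have Hz y : K y -> dot u z <= dot u y by move=> /Hz'; rewrite !dotNl lerN2.
exists x, z; split=> //; first by move=> y Ky; rewrite Hz // Hx.
rewrite dotDr dotNr -(wK u1) /width; congr (_ - _).
- apply/eqP; rewrite eq_le; apply/andP; split.
    by apply: ub_le_sup; [exists (dot u x) => _ [y Ky <-]; exact: Hx|exists x].
  by apply: ge_sup; [exists (dot u x), x|move=> _ [y Ky <-]; exact: Hx].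
- apply/eqP; rewrite eq_le; apply/andP; split.
    by apply: lb_le_inf; [exists (dot u z), z|move=> _ [y Ky <-]; exact: Hz].
  by apply: ge_inf; [exists (dot u z) => _ [y Ky <-]; exact: Hz|exists z].
Qed.

(** The width in the direction of [x - y] bounds the distance. *)
Lemma diam_le2 x y : K x -> K y -> dist x y <= 2.
Proof.
move=> Kx Ky; have [->|xy] := eqVneq x y.
  by rewrite distxx.
have d0 : x - y != 0 by rewrite subr_eq0.
have [a [b [Ka Kb H Hab]]] := width_attained (enorm_unit d0).
have /andP[_ h1] := H _ Kx; have /andP[h2 _] := H _ Ky.
have e0 := enorm_gt0 d0.
have : dot ((enorm (x - y))^-1 *: (x - y)) (x - y) <= 2.
  by move: Hab; rewrite !dotDr !dotNr; lra.
rewrite dotZl -enorm_sq expr2 mulKf ?gt_eqF //.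
Qed.

(** Let [b] be a point of [K] on the opposite support plane. Then [dot u (x - b)] is at least 2
    while [dist x b] is at most 2, which forces [x - b = 2 *: u]. *)
Lemma opposite_point x u : K x -> enorm u = 1 ->
  (forall z, K z -> dot u (z - x) <= 0) -> K (x - 2 *: u).
Proof.
move=> Kx u1 Hu; have [a [b [Ka Kb H Hab]]] := width_attained u1.
have xb : 2 <= dot u (x - b).
  by have := Hu _ Ka; move: Hab; rewrite !dotDr !dotNr; lra.
have := diam_le2 Kx Kb; rewrite /dist enorm_le // => xb2.
have /enorm1P u11 := u1.
suff -> : x - 2 *: u = b by [].
apply/eqP; rewrite -subr_eq0; apply/eqP; apply: dot_eq0; apply/eqP.
rewrite eq_le dot_ge0 andbT (_ : _ - _ = (x - b) - 2 *: u); last by vec.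
move: xb xb2; set w := x - b => xb xb2; clearbody w.
by rewrite !dot_lin (dotC w u) u11; lra.
Qed.

Lemma boundary_dist2 x y : K x -> K y -> dist x y = 2 -> boundary K x.
Proof.
move=> Kx Ky xy; split; first exact: subset_closure.
move=> /(interior_line (x - y))[e e0 H].
have /diam_le2 : K (x + (e / 2) *: (x - y)).
  by apply: H; rewrite gtr0_norm; lra.
move=> /(_ _ Ky); rewrite /dist (_ : _ - y = (1 + e / 2) *: (x - y)); last by vec.
rewrite enormZ -/(dist x y) xy gtr0_norm; lra.
Qed.

(** [K] lies in the ball of radius 2 around [y], whose tangent plane at [x] therefore supports
    [K]. *)
Lemma dist2_normal x y : K y -> dist x y = 2 ->
  forall z, K z -> dot (x - y) (z - x) <= 0.
Proof.
move=> Ky xy z Kz; have := diam_le2 Kz Ky.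
move: xy => /dist2_sq; rewrite /dist enorm_le //.
rewrite (_ : z - y = (z - x) + (x - y)); last by vec.
set a := z - x; set w := x - y; clearbody a w => ww.
by rewrite !dot_lin (dotC a w) ww; have := dot_ge0 a; lra.
Qed.

Lemma convexK x y t : K x -> K y -> 0 <= t <= 1 -> K (x + t *: (y - x)).
Proof.
move=> Kx Ky /andP[t0 t1]; case: bK => _ /(_ y x (Itv01 t0 t1)) H _.
have -> : x + t *: (y - x) = t *: y + (1 - t) *: x by vec.
exact: set_mem (H (mem_set Ky) (mem_set Kx)).
Qed.

Lemma nearest_normal z : ~ K z -> exists x, [/\ K x, z - x != 0 &
  forall y, K y -> dot (z - x) (y - x) <= 0].
Proof.
move=> nKz; have [x /set_mem Kx H] := EVT_min_rV K0 cK (continuous_subspaceT (@dot_sub_continuous z)).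
exists x; split=> //.
  by rewrite subr_eq0; apply/eqP => E; apply: nKz; rewrite E.
move=> y Ky; set u := z - x; set w := y - x.
rewrite leNgt; apply/negP => uw.
(* A step from [x] towards [y] that stays on the segment and is short enough to come closer to [z];
   the [+ 1] keeps the divisor positive. *)
pose t := Order.min 1 (dot u w / (dot w w + 1)).
have w1 : 0 < dot w w + 1 by rewrite ltr_wpDl ?dot_ge0.
have t0 : 0 < t by rewrite lt_min ltr01 divr_gt0.
have t1 : t <= 1 by rewrite ge_min lexx.
have tw : t * (dot w w + 1) <= dot u w by rewrite -ler_pdivlMr // ge_min lexx orbT.
have /mem_set/H : K (x + t *: w) by apply: convexK => //; rewrite (ltW t0).
rewrite -/u (_ : z - _ = u - t *: w); last by rewrite /u; vec.
clearbody u w t => h; move: h.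
rewrite !dot_lin (dotC w u) => h.
have : t * (t * (dot w w + 1)) <= t * dot u w by rewrite ler_pM2l.
have : 0 < t * dot u w by rewrite mulr_gt0.
have : 0 < t * t by rewrite mulr_gt0.
lra.
Qed.

End Body.
End ConstantWidth.

(** * Symmetry and singularities of Robert's body *)

Section Isometry.
Variables (R : realType) (f : E3 R -> E3 R).
Hypothesis isof : euclidean_isometry f.
Implicit Types (p q r s x y z : E3 R) (b t : R).

(** The linear part of [f]; it preserves [dot] by polarization. *)
Let g x : E3 R := f x - f 0.

Let g_dot x y : dot (g x) (g y) = dot x y.
Proof.
have D a c : dot (f a - f c) (f a - f c) = dot (a - c) (a - c).
  by rewrite -!enorm_sq -/(dist _ _) -/(dist a c) isof.
have := D x y; have := D x 0; have := D y 0; rewrite !subr0.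
have -> : f x - f y = g x - g y by rewrite /g; vec.
rewrite -/(g x) -/(g y); move: (g x) (g y) => a c.
by rewrite !dot_lin (dotC c a) (dotC y x); lra.
Qed.

(** The difference of the two sides is orthogonal to every value of [g] and is itself a combination
    of such values. *)
Let g_lin t x y : g (x + t *: y) = g x + t *: g y.
Proof.
apply/eqP; rewrite -subr_eq0; apply/eqP; apply: dot_eq0.
have H z : dot (g (x + t *: y) - (g x + t *: g y)) (g z) = 0.
  by rewrite dotDl dotNl dotDl dotZl !g_dot dotDl dotZl subrr.
by rewrite dotDr dotNr dotDr dotZr !H; ring.
Qed.

Let g0 : g 0 = 0. Proof. exact: subrr. Qed.
Let gZ t x : g (t *: x) = t *: g x.
Proof. by rewrite -[t *: x]add0r g_lin g0 add0r. Qed.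
Let gD x y : g (x + y) = g x + g y.
Proof. by rewrite -{1}[y]scale1r g_lin scale1r. Qed.
Let gN x : g (- x) = - g x.
Proof. by rewrite -scaleN1r gZ scaleN1r. Qed.
Let fE x : f x = f 0 + g x.
Proof. by rewrite /g addrC subrK. Qed.

Lemma isometry_ppt p q r s b :
  f (ppt p q r s b) = ppt (f p) (f q) (f r) (f s) b.
Proof.
rewrite [LHS]fE /ppt /axv /mid /hdiff !(gD, gN, gZ) (fE p) (fE q) (fE r) (fE s).
by set a := prho b; set c := (sq2 R)^-1; clearbody a c g; vec.
Qed.

Lemma isometry_phi x t y : f (phi x t y) = phi (f x) t (f y).
Proof.
rewrite /phi isof [LHS]fE !(gD, gN, gZ) (fE x) (fE y).
by set a := t / _; vec.
Qed.

Lemma isometry_wpt p q r s b t :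
  f (wpt p q r s b t) = wpt (f p) (f q) (f r) (f s) b t.
Proof. by rewrite /wpt isometry_phi !isometry_ppt. Qed.

Lemma isometry_surj (e1 e2 e3 : E3 R) : onf e1 e2 e3 -> forall z, exists x, f x = z.
Proof.
case=> -[h1 h2 h3] [h12 h13 h23] z.
have on' : onf (g e1) (g e2) (g e3) by split; split; rewrite g_dot.
set w := z - f 0.
exists (dot w (g e1) *: e1 + dot w (g e2) *: e2 + dot w (g e3) *: e3).
by rewrite fE !gD !gZ -(onf_expand on') /w addrC subrK.
Qed.

End Isometry.

(** * Choice of a direction avoiding finitely many quadratic conditions *)

Section ArcAvoid.
Variable R : realType.
Implicit Types (a u : E3 R) (p : {poly R}).

Lemma poly_nonroot01 p : p != 0 -> exists2 t, 0 <= t <= 1 & p.[t] != 0.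
Proof.
move=> p0; apply: contrapT => H.
(* These are [size p] distinct points of the unit interval, too many to be all roots of [p]. *)
pose rs : seq R := [seq n.+1%:R^-1 | n <- iota 0 (size p)].
have : (size rs < size p)%N.
  apply: max_poly_roots => //.
    apply/allP => _ /mapP[n _ ->]; apply/negPn/negP => Hn; apply: H.
    exists n.+1%:R^-1 => //.
    by rewrite invr_ge0 ler0n invf_le1 ?ltr0n // ler1n.
  rewrite map_inj_uniq ?iota_uniq // => m n /invr_inj/eqP.
  by rewrite eqr_nat eqSS => /eqP.
by rewrite size_map size_iota ltnn.
Qed.

(* [2 / |u| *: u] can be at distance 2 from [a k] only if
   [(a k . a k)^2 (u . u) = 16 (a k . u)^2], a quadratic equation in [t]. *)
Lemma segment_avoid (I : finType) (a : I -> E3 R) u1 u2 :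
  (forall k, a k != 0) -> dot u1 u1 = 1 -> dot u2 u2 = 1 ->
  u1 != u2 -> u1 != - u2 ->
  exists2 t, 0 <= t <= 1 & forall k, let u := u1 + t *: (u2 - u1) in
    dot (a k) (a k) ^+ 2 * dot u u != 16 * dot (a k) u ^+ 2.
Proof.
move=> a0 h1 h2 n12 nN12.
set d := u2 - u1.
pose P k : {poly R} := (dot (a k) (a k) ^+ 2)%:P *
   (1%:P + (2 * dot u1 d)%:P * 'X + (dot d d)%:P * 'X^2)
  - 16%:P * ((dot (a k) u1)%:P + (dot (a k) d)%:P * 'X) ^+ 2.
have PE k t : (P k).[t] = dot (a k) (a k) ^+ 2 * dot (u1 + t *: d) (u1 + t *: d)
   - 16 * dot (a k) (u1 + t *: d) ^+ 2.
  rewrite /P !(hornerD, hornerN, hornerM, horner_exp, hornerC, hornerX, hornerXn).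
  clearbody d.
  by rewrite !dot_lin (dotC d u1) h1; ring.
have u12 : dot u1 u2 ^+ 2 < 1.
  have p1 : 0 < dot (u1 - u2) (u1 - u2) by rewrite dot_gt0 // subr_eq0.
  have p2 : 0 < dot (u1 + u2) (u1 + u2) by rewrite dot_gt0 // addr_eq0.
  by move: p1 p2; rewrite !dot_lin (dotC u2 u1) h1 h2; nra.
have P0 k : P k != 0.
  apply/eqP => Pk; have aa := dot_gt0 (a0 k).
  have E t : dot (a k) (a k) ^+ 2 * dot (u1 + t *: d) (u1 + t *: d) =
     16 * dot (a k) (u1 + t *: d) ^+ 2.
    by apply/eqP; rewrite -subr_eq0 -PE Pk horner0.
  (* The values at 0 and 1 give [x = y] or [x = - y]. With the value at 1/2, the cosine [c] of the
     angle between [u1] and [u2] would be 1 or -1. *)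
  have := E 0; have := E 1; have := E 2^-1; rewrite /d.
  rewrite !dot_lin (dotC u2 u1) h1 h2; move: aa u12.
  set A := dot (a k) (a k); set c := dot u1 u2.
  set x := dot (a k) u1; set y := dot (a k) u2 => A0 c1 E2 E1 E0.
  have {}E0 : A ^+ 2 = 16 * x ^+ 2 by lra.
  have {}E1 : A ^+ 2 = 16 * y ^+ 2 by lra.
  have {}E2 : A ^+ 2 * (1 + c) = 8 * (x + y) ^+ 2 by lra.
  have : (x - y) * (x + y) = 0 by lra.
  have A2 : 0 < A ^+ 2 by rewrite exprn_gt0.
  have A2' : A ^+ 2 != 0 by rewrite gt_eqF.
  move=> /eqP; rewrite mulf_eq0 => /orP[]/eqP H.
    have Exy : y = x by lra.
    have Ec : 1 + c = 2 by apply: (mulfI A2'); rewrite E2 Exy E0; ring.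
    by move: c1; rewrite (_ : c = 1) ?expr1n ?ltxx //; lra.
  have Ec : 1 + c = 0 by apply: (mulfI A2'); rewrite E2 H; ring.
  by move: c1; rewrite (_ : c = -1) ?sqrrN ?expr1n ?ltxx //; lra.
have [t t01 Ht] : exists2 t, 0 <= t <= 1 & (\prod_k P k).[t] != 0.
  by apply: poly_nonroot01; rewrite prodf_seq_neq0; apply/allP => k _; rewrite P0.
exists t => // k /=; move: Ht; rewrite horner_prod.
by rewrite prodf_seq_neq0 => /allP/(_ k (mem_index_enum k)); rewrite PE subr_eq0.
Qed.

End ArcAvoid.

(** * Wedges and caps of Robert's body, its normals and its symmetry *)

Section RobertBody.
Variables (R : realType) (v : 'I_4 -> E3 R) (K : set (E3 R)).
Hypotheses (hv : regular_tetrahedron v 2) (hK : robert_body v K).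
Implicit Types (x y z u : E3 R) (i j k l : 'I_4) (b t : R).

Let bK : convex_body K. Proof. by case: hK. Qed.
Let wK : constant_width K 2. Proof. by case: hK. Qed.
Let cK : compact K. Proof. by case: bK. Qed.

Lemma vertices_tetra i j k l : uniq [:: i; j; k; l] -> tetra (v i) (v j) (v k) (v l).
Proof.
rewrite /= !inE !negb_or => /and4P[/and3P[ij ik il] /andP[jk jl] kl _].
by split; split; apply: hv.
Qed.

Lemma vertex_inj : injective v.
Proof.
move=> i j E; apply/eqP; apply/negPn/negP => /hv.
by rewrite E distxx => /eqP; rewrite eq_sym pnatr_eq0.
Qed.

Lemma other_vertices k : exists i j l, uniq [:: k; i; j; l].
Proof.
exists (k + 1), (k + 2%:R), (k + 3%:R).
by case: k => [[|[|[|[|//]]]] hk].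
Qed.

Lemma wedge_podsP z : wedge_pods v z <-> exists i j k l b t,
  [/\ uniq [:: i; j; k; l], `|b| <= 1, `|t| <= 1 &
      z = wpt (v i) (v j) (v k) (v l) b t].
Proof.
split.
  move=> [i [j [k [l [U [S1 [S2 [x [rho [y [P Hx [rho' Hy] ->]]]]]]]]]]].
  have T := vertices_tetra U.
  move: Hx => /(pod_pair_pea_disk T P)[b b1 [-> ->]].
  move: Hy => /(pod_pair_pea_disk (tetra_swap T) (pod_pair_sym P))[t t1 [_ ->]].
  by exists i, j, k, l, b, t.
move=> [i [j [k [l [b [t [U b1 t1 ->]]]]]]].
have T := vertices_tetra U; have P := pod_pair_dev T.
exists i, j, k, l; split=> //.
exists (pod_dev (v i) (v j) (v k) (v l)), (pod_dev (v k) (v l) (v i) (v j)).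
exists (ppt (v i) (v j) (v k) (v l) b), (prho b), (ppt (v k) (v l) (v i) (v j) t).
split=> //; first by apply/(pod_pair_pea_disk T P); exists b.
exists (prho t); apply/(pod_pair_pea_disk (tetra_swap T) (pod_pair_sym P)).
by exists t.
Qed.

Lemma uniq_swap i j k l : uniq [:: i; j; k; l] -> uniq [:: k; l; i; j].
Proof. by rewrite -[[:: k; l; i; j]]/(rot 2 [:: i; j; k; l]) rot_uniq. Qed.

(** A point of a bounding curve of a cap is the wedge point with [t = 1], where the opposite pea
    center is the vertex itself; the rest of the cap lies on the sphere by definition. *)
Lemma surface_cases z : robert_surface v z ->
  wedge_pods v z \/ exists k, dist z (v k) = 2.
Proof.
case=> [|[k _]]; first by left.
case=> [[i [j [l [U [S1 [S2 [x [rho [P Hx ->]]]]]]]]]|[[dk _] _]]; last by right; exists k.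
right; exists k.
have T := vertices_tetra U; move: Hx => /(pod_pair_pea_disk T P)[b b1 [-> ->]].
by have := dist_wpt_end b T (or_introl (erefl 1)); rewrite /wpt ppt1.
Qed.

Lemma boundary_cases z : boundary K z ->
  wedge_pods v z \/ exists k, dist z (v k) = 2.
Proof. by case: hK => _ _ -> /surface_cases. Qed.

Lemma wedge_sub z : wedge_pods v z -> K z.
Proof.
move=> Wz; apply: (compact_boundary_sub cK).
by case: hK => _ _ ->; left.
Qed.

Lemma wpt_in i j k l b t : uniq [:: i; j; k; l] -> `|b| <= 1 -> `|t| <= 1 ->
  K (wpt (v i) (v j) (v k) (v l) b t).
Proof. by move=> U b1 t1; apply/wedge_sub/wedge_podsP; exists i, j, k, l, b, t. Qed.

Lemma vertex_wedge k : wedge_pods v (v k).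
Proof.
have [i [j [l U]]] := other_vertices k; apply/wedge_podsP.
exists k, i, j, l, 1, 0; split; rewrite ?normr0 ?normr1 //.
by rewrite wpt_ext ?ppt1 //; left.
Qed.

Lemma vertex_in k : K (v k).
Proof. exact/wedge_sub/vertex_wedge. Qed.

Lemma boundary_opposite x : boundary K x -> exists2 y, K y & dist x y = 2.
Proof.
case/boundary_cases => [/wedge_podsP[i [j [k [l [b [t [U b1 t1 ->]]]]]]]|[k dk]].
  exists (wpt (v k) (v l) (v i) (v j) t b); first exact: wpt_in (uniq_swap U) t1 b1.
  exact: dist_wpt_opp (vertices_tetra U).
by exists (v k) => //; exact: vertex_in.
Qed.

(** By [wedge_normal] both [y - x] and [y - y'] are multiples of [W], and both have length 2. If
    they were opposite, [x] and [y'] would be at distance 4, beyond the diameter. *)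
Lemma wedge_opposite i j k l b t x : uniq [:: i; j; k; l] ->
  `|b| < 1 -> `|t| < 1 -> K x -> dist (wpt (v i) (v j) (v k) (v l) b t) x = 2 ->
  x = wpt (v k) (v l) (v i) (v j) t b.
Proof.
move=> U b1 t1 Kx d2; have T := vertices_tetra U.
set y := wpt (v i) _ _ _ _ _ in d2; set y' := wpt _ _ _ _ _ _.
have Ky' : K y' by apply: wpt_in (uniq_swap U) _ _; exact: ltW.
have [c Ec] : exists c, y - x = c *: wvec (v i) (v j) (v k) (v l) b t.
  apply: wedge_normal => // b' t' b'1 t'1.
  by apply: (dist2_normal bK wK Kx d2); exact: wpt_in.
have Ey : y - y' = (2 / wdist b t) *: wvec (v i) (v j) (v k) (v l) b t.
  exact: wpt_opp.
have WW := wvec_sq b t T; have D0 := wdist_gt0 b t.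
set W := wvec _ _ _ _ _ _ in Ec Ey WW; set D := wdist b t in Ey WW D0.
have cD : c * c * (D * D) = 4.
  move: d2 => /dist2_sq; rewrite Ec dotZl dotZr WW.
  by rewrite !expr2 mulrA; lra.
have Exy : x - y' = (2 / D - c) *: W.
  by rewrite scalerBl -Ey -Ec opprB [RHS]addrC addrA subrK.
have := diam_le2 bK wK Kx Ky'; rewrite /dist enorm_le // Exy dotZl dotZr WW.
have -> : (2 / D - c) * ((2 / D - c) * D ^+ 2) = (2 - c * D) ^+ 2 by field; rewrite gt_eqF.
move=> H; apply/eqP; rewrite -subr_eq0 Exy.
have -> : 2 / D - c = 0; last by rewrite scale0r.
have cD2 : c * D = 2.
  have : (c * D - 2) * (c * D + 2) = 0 by lra.
  by move/eqP; rewrite mulf_eq0 => /orP[]/eqP; nra.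
by rewrite -cD2 mulfK ?subrr // gt_eqF.
Qed.

Lemma normals_eq x u1 u2 : boundary K x -> ~ range v x ->
  enorm u1 = 1 -> enorm u2 = 1 ->
  (forall z, K z -> dot u1 (z - x) <= 0) ->
  (forall z, K z -> dot u2 (z - x) <= 0) -> u1 = u2.
Proof.
move=> bx nvx n1 n2 H1 H2; have Kx := compact_boundary_sub cK bx.
apply/eqP/negPn/negP => n12.
have opp u : enorm u = 1 -> (forall z, K z -> dot u (z - x) <= 0) ->
    K (x - 2 *: u) /\ dist x (x - 2 *: u) = 2.
  move=> nu Hu; split; first exact: (opposite_point bK wK).
  by rewrite /dist opprB addrC subrK enormZ nu ger0_norm ?mulr1.
(* Opposite normals would give two points of [K] at distance 4. *)
have nN12 : u1 != - u2.
  apply/eqP => E; have [K1 _] := opp _ n1 H1; have [K2 _] := opp _ n2 H2.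
  have := diam_le2 bK wK K1 K2; rewrite /dist E.
  rewrite (_ : _ - _ = 4 *: u2); last by vec.
  by rewrite enormZ n2 ger0_norm //; lra.
have interior_smooth i j k l b t : uniq [:: i; j; k; l] -> `|b| < 1 -> `|t| < 1 ->
    x <> wpt (v i) (v j) (v k) (v l) b t.
  move=> U b1 t1 E; have [K1 d1] := opp _ n1 H1; have [K2 d2] := opp _ n2 H2.
  rewrite {1}E in d1; rewrite {1}E in d2.
  have E1 := wedge_opposite U b1 t1 K1 d1; have E2 := wedge_opposite U b1 t1 K2 d2.
  move: n12 => /eqP; apply; have : x - 2 *: u1 = x - 2 *: u2 by rewrite E1 E2.
  by move=> /addrI/oppr_inj/scalerI; apply; rewrite pnatr_eq0.
have a0 k : x - v k != 0.
  by rewrite subr_eq0; apply/eqP => E; apply: nvx; exists k.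
have /enorm1P n11 := n1; have /enorm1P n22 := n2.
(* The combination [u] of the two normals is again normal at [x], and [t] is chosen so that the
   opposite point [y] is at distance 2 from no vertex. *)
have [t /andP[t0 t1] /= Ht] := segment_avoid a0 n11 n22 n12 nN12.
set u := u1 + _ in Ht.
have u0 : u != 0.
  apply/eqP => E; have := Ht ord0; rewrite E dot0l dot0r expr0n /= !mulr0 eqxx //.
have Hu z : K z -> dot ((enorm u)^-1 *: u) (z - x) <= 0.
  move=> Kz; rewrite dotZl pmulr_rle0 ?invr_gt0 ?enorm_gt0 //.
  have := H1 _ Kz; have := H2 _ Kz; rewrite /u; move: (z - x) => w h2 h1.
  by rewrite dotDl dotZl dotDl dotNl; nra.
have [Ky dy] := opp _ (enorm_unit u0) Hu.
set y := x - _ in Ky dy.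
have yv k : dist y (v k) <> 2.
  move=> /dist2_sq E; have := Ht k; apply/negP/negPn/eqP.
  have e0 := enorm_gt0 u0.
  move: E; rewrite /y (_ : _ - _ = (x - v k) - (2 / enorm u) *: u); last by rewrite scalerA; vec.
  have uu := enorm_sq u.
  move: (x - v k) => a; move: (enorm u) e0 uu => e e0 uu; rewrite -uu.
  clearbody u; rewrite !dot_lin (dotC u a) -uu => E.
  have E' : dot a a * e = 4 * dot a u.
    have e1 : e != 0 by rewrite gt_eqF.
    apply: (mulIf e1); move: E => /(congr1 (fun s => s * e ^+ 2)).
    set A := dot a a; set B := dot a u.
    rewrite (_ : _ * e ^+ 2 = A * e ^+ 2 - 4 * B * e + 4 * e ^+ 2); last by field.
    by lra.
  by rewrite -exprMn E' exprMn; congr (_ * _); ring.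
have by_ : boundary K y by apply: (boundary_dist2 bK wK Ky Kx); rewrite distC.
case: (boundary_cases by_) => [|[k /yv]] //.
move=> /wedge_podsP[i [j [k [l [b [s [U b1 s1 Ey]]]]]]].
have nonvertex m : y <> v m.
  move=> E; have [m' [? [? /= Um]]] := other_vertices m.
  by apply: (yv m'); rewrite E; apply: hv; move: Um; rewrite !inE !negb_or => /andP[/andP[]].
have lt1 (c : R) : `|c| <= 1 -> c <> 1 -> c <> - 1 -> `|c| < 1.
  rewrite le_eqVlt => /orP[/eqP H|//] c1 c2; exfalso.
  by move: H; case: (ger0P c) => _ H; [apply: c1|apply: c2; rewrite -H opprK].
(* An extreme [b] would make [y] a vertex, and an extreme [s] would put it at distance 2 from
   one. *)
have b1' : `|b| < 1.
  apply: lt1 => // E.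
    by apply: (nonvertex i); rewrite Ey wpt_ext ?E ?ppt1 //; left.
  by apply: (nonvertex j); rewrite Ey wpt_ext ?E ?pptN1 //; right.
have T := vertices_tetra U.
have s1' : `|s| < 1.
  apply: lt1 => // E.
    by apply: (yv k); rewrite Ey -(dist_wpt_end b T (or_introl E)) E ppt1.
  by apply: (yv l); rewrite Ey -(dist_wpt_end b T (or_intror E)) E pptN1.
rewrite distC Ey in dy.
exact: (interior_smooth _ _ _ _ _ _ (uniq_swap U) s1' b1' (wedge_opposite U b1' s1' Kx dy)).
Qed.

Lemma support_plane_unique x : boundary K x -> ~ range v x ->
  exists! P : set (E3 R), support_plane K x P.
Proof.
move=> bx nvx; have Kx := compact_boundary_sub cK bx.
have [y Ky dxy] := boundary_opposite bx.
have u0 : x - y != 0.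
  rewrite subr_eq0; apply/eqP => E; move: dxy; rewrite E distxx => /eqP.
  by rewrite eq_sym pnatr_eq0.
have Hu := dist2_normal bK wK Ky dxy.
exists (plane_at x (x - y)); split; first by exists (x - y).
move=> _ [u' [u'0 -> Hu']].
have unit_normal u : u != 0 -> (forall z, K z -> dot u (z - x) <= 0) ->
    forall z, K z -> dot ((enorm u)^-1 *: u) (z - x) <= 0.
  by move=> un H z /H; rewrite dotZl pmulr_rle0 // invr_gt0 enorm_gt0.
have E := normals_eq bx nvx (enorm_unit u0) (enorm_unit u'0)
  (unit_normal _ u0 Hu) (unit_normal _ u'0 Hu').
have planeE u : u != 0 -> plane_at x u = plane_at x ((enorm u)^-1 *: u).
  move=> un; apply/seteqP; split=> z; rewrite /plane_at /= dotZl; first by move=> ->; rewrite mulr0.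
  by move/eqP; rewrite mulf_eq0 invr_eq0 gt_eqF ?enorm_gt0 //= => /eqP.
by rewrite planeE // E -planeE.
Qed.

(** For [z] outside [K] with nearest point [x], the point [y] opposite to [x] is farther than 2 from
    [z], so it is no wedge point. It is then at distance 2 from some [v k], and the uniqueness of
    its normal gives [x = v k]. *)
Lemma body_wedgeP z : K z <-> forall y, wedge_pods v y -> dist z y <= 2.
Proof.
split=> [Kz y /wedge_sub Ky|H]; first exact: (diam_le2 bK wK).
apply: contrapT => nKz; have [x [Kx n0 Hn]] := nearest_normal bK nKz.
set n := z - x in n0 Hn; have e0 := enorm_gt0 n0.
pose u := (enorm n)^-1 *: n.
have u1 : enorm u = 1 by exact: enorm_unit.
have Hu w : K w -> dot u (w - x) <= 0.
  by move=> /Hn; rewrite /u dotZl pmulr_rle0 // invr_gt0.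
have Ky := opposite_point bK wK Kx u1 Hu; set y := x - _ in Ky.
have dyx : dist y x = 2.
  by rewrite distC /dist opprB addrC subrK enormZ u1 ger0_norm ?mulr1.
have En : n = enorm n *: u by rewrite /u scalerA mulfV ?scale1r // gt_eqF.
have nWy : ~ wedge_pods v y.
  move=> /H; rewrite /dist (_ : z - y = (enorm n + 2) *: u); last first.
    by rewrite scalerDl -En /n /y; vec.
  by rewrite enormZ u1 ger0_norm; lra.
case: (boundary_cases (boundary_dist2 bK wK Ky Kx dyx)) => // -[k dyk].
have Ex : x = v k.
  have ny : ~ range v y by move=> [m _ E]; apply: nWy; rewrite -E; exact: vertex_wedge.
  have N w : K w -> dist y w = 2 -> enorm (2^-1 *: (y - w)) = 1 /\
      forall w', K w' -> dot (2^-1 *: (y - w)) (w' - y) <= 0.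
    move=> Kw dw; split; first by rewrite enormZ -/(dist y w) dw ger0_norm ?mulVf ?invr_ge0.
    by move=> w' /(dist2_normal bK wK Kw dw) h; rewrite dotZl; lra.
  have [a1 a2] := N _ Kx dyx; have [b1 b2] := N _ (vertex_in k) dyk.
  have := normals_eq (boundary_dist2 bK wK Ky Kx dyx) ny a1 b1 a2 b2.
  move=> /scalerI; rewrite invr_eq0 pnatr_eq0 => /(_ isT).
  by move=> /addrI/oppr_inj.
(* Another vertex [v j] is within 2 of [y] and at distance 2 from [x = v k], so going from [x] to
   [z] along [u] takes one farther than 2 from [v j], a wedge point. *)
have [j [? [? /= Uj]]] := other_vertices k.
have kj : dist (v k) (v j) = 2.
  by apply: hv; move: Uj; rewrite !inE !negb_or => /andP[/andP[]].
have := H _ (vertex_wedge j); have := diam_le2 bK wK Ky (vertex_in j).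
move: kj => /dist2_sq; have /enorm1P u11 := u1.
rewrite /dist !enorm_le //.
rewrite (_ : y - v j = (v k - v j) - 2 *: u); last by rewrite /y Ex; vec.
rewrite (_ : z - v j = (v k - v j) + enorm n *: u); last by rewrite -En /n Ex; vec.
move: (v k - v j) (enorm n) e0 => a e e0; clearbody u.
rewrite !dot_lin (dotC u a) u11; set A := dot a a; set B := dot a u => EA E1 E2.
have : 0 < e * B by rewrite mulr_gt0 //; lra.
have : 0 < e * e by rewrite mulr_gt0.
by lra.
Qed.

(** The isometry permutes the vertices, hence the wedge points, and [body_wedgeP] describes [K] by
    distances to these. The index map [tau] carries wedge points forward along [f] and [sigma] pulls
    them back. *)
Lemma body_symmetric f : euclidean_isometry f ->
  f @` range v = range v -> f @` K = K.
Proof.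
move=> isof fv.
have /choice[tau Htau] : forall i, exists j, f (v i) = v j.
  move=> i; have : range v (f (v i)) by rewrite -fv; exists (v i) => //; exists i.
  by move=> [j _ <-]; exists j.
have /choice[sigma Hsigma] : forall i, exists j, f (v j) = v i.
  move=> i; have : (f @` range v) (v i) by rewrite fv; exists i.
  by move=> [_ [j _ <-] <-]; exists j.
have tau_inj : injective tau.
  by move=> i j E; apply: vertex_inj; apply: dist_eq0; rewrite -isof !Htau E distxx.
have sigma_inj : injective sigma.
  by move=> i j E; apply: vertex_inj; rewrite -(Hsigma i) -(Hsigma j) E.
have uniq_map (s : 'I_4 -> 'I_4) i j k l : injective s ->
    uniq [:: i; j; k; l] -> uniq [:: s i; s j; s k; s l].
  by move=> sI; rewrite -[X in _ -> is_true (uniq X)]/(map s [:: i; j; k; l]) map_inj_uniq.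
apply/seteqP; split=> [_ [z Kz <-]|z Kz].
  apply/body_wedgeP => _ /wedge_podsP[i [j [k [l [b [t [U b1 t1 ->]]]]]]].
  rewrite -(Hsigma i) -(Hsigma j) -(Hsigma k) -(Hsigma l) -isometry_wpt // isof; apply: (diam_le2 bK wK) => //.
  exact: wpt_in (uniq_map _ _ _ _ _ sigma_inj U) b1 t1.
have [i [j [k U]]] := other_vertices ord0.
have [x Ex] := isometry_surj isof (tetra_onf (vertices_tetra U)) z.
exists x => //; apply/body_wedgeP => _ /wedge_podsP[i' [j' [k' [l' [b [t [U' b1 t1 ->]]]]]]].
rewrite -isof Ex isometry_wpt // !Htau; apply: (diam_le2 bK wK) => //.
exact: wpt_in (uniq_map _ _ _ _ _ tau_inj U') b1 t1.
Qed.

(* The normal cone at [v i] contains the three differences [v i - v j], hence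
   the open cone of their positive combinations, cut out below by the dual
   basis. *)
Lemma vertex_normal_cone i : interior (normal_cone K (v i)) !=set0.
Proof.
have [j [k [l U]]] := other_vertices i; have T := vertices_tetra U.
pose a m : E3 R := v i - v m.
have Na m : dist (v i) (v m) = 2 -> forall z, K z -> dot (a m) (z - v i) <= 0.
  by move=> d; apply: (dist2_normal bK wK (vertex_in m) d).
have [[dij dik dil] [djk djl dkl]] := T.
have jj := dist2_sq dij; have kk := dist2_sq dik; have ll := dist2_sq dil.
rewrite -/(a j) -/(a k) -/(a l) in jj kk ll.
have kj := dist2_sq djk; rewrite (_ : v j - v k = a k - a j) in kj; last by rewrite /a; vec.
have lj := dist2_sq djl; rewrite (_ : v j - v l = a l - a j) in lj; last by rewrite /a; vec.
have lk := dist2_sq dkl; rewrite (_ : v k - v l = a l - a k) in lk; last by rewrite /a; vec.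
have nj := Na _ dij; have nk := Na _ dik; have nl := Na _ dil.
have on := tetra_onf T.
have Ea : axv (v i) (v j) (v k) (v l) = (2 * sq2 R)^-1 *: (a k + a l - a j).
  by rewrite /axv /mid /a; apply/rowP => m; rewrite !mxE; field; exact: sq2_neq0.
have Eh : hdiff (v i) (v j) = 2^-1 *: a j by [].
have Eh' : hdiff (v k) (v l) = 2^-1 *: (a l - a k) by rewrite /hdiff /a; vec.
rewrite Ea Eh Eh' in on.
move: (a j) (a k) (a l) jj kk ll kj lj lk nj nk nl on => aj ak al' jj kk ll kj lj lk nj nk nl on.
move: kj lj lk; rewrite !dot_lin jj kk ll (dotC ak aj) (dotC al' aj) (dotC al' ak) => kj lj lk.
have jk : dot aj ak = 2 by lra.
have jl : dot aj al' = 2 by lra.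
have kl : dot ak al' = 2 by lra.
(* The Gram matrix of the three differences is [2 (I + J)] with [J] the all-ones matrix; its inverse
   [(I - J / 4) / 2] yields the dual basis. *)
pose g (c d e : E3 R) : E3 R := 2^-1 *: (c - 4^-1 *: (c + d + e)).
pose O := [set u | 0 < dot (g aj ak al') u] `&` [set u | 0 < dot (g ak al' aj) u]
  `&` [set u | 0 < dot (g al' aj ak) u].
have oO : open O.
  have oG (c : E3 R) : open [set u | 0 < dot c u].
    rewrite (_ : [set u | _] = dot c @^-1` [set y | 0 < y]) //.
    by have /continuousP := @dot_continuous R c; apply; exact: open_gt.
  by apply: openI => //; exact: openI.
exists (aj + ak + al').
have : O `<=` normal_cone K (v i).
  move=> u [[uj uk] ul]; rewrite /= in uj uk ul; split; first exact: vertex_in.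
  move=> z Kz; have Eu : u = dot (g aj ak al') u *: aj + dot (g ak al' aj) u *: ak
      + dot (g al' aj ak) u *: al'.
    apply/eqP; rewrite -subr_eq0; apply/eqP.
    set w := u - _.
    have [wj wk wl] : [/\ dot w aj = 0, dot w ak = 0 & dot w al' = 0].
      rewrite /w /g !dot_lin jj kk ll (dotC ak aj) (dotC al' aj) (dotC al' ak) jk jl kl.
      by rewrite (dotC aj u) (dotC ak u) (dotC al' u); split; field.
    apply: (onf_eq0 on); rewrite !(dotZr, dotDr, dotNr) ?wj ?wk ?wl; ring.
  move: uj uk ul Eu; move: (dot _ u) (dot _ u) (dot _ u) => c d e c0 d0 e0 ->.
  have := nj _ Kz; have := nk _ Kz; have := nl _ Kz.
  rewrite !dotDl !dotZl => h1 h2 h3.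
  have := mulr_ge0_le0 (ltW c0) h3; have := mulr_ge0_le0 (ltW d0) h2.
  by have := mulr_ge0_le0 (ltW e0) h1; lra.
rewrite open_subsetE //; apply; rewrite /O /g /=.
rewrite !dot_lin jj kk ll (dotC ak aj) (dotC al' aj) (dotC al' ak) jk jl kl.
by split; [split|]; lra.
Qed.

End RobertBody.

Unset Implicit Arguments.

Theorem mainTheorem4 (R : realType) (v : 'I_4 -> E3 R) (K : set (E3 R))
    (hv : regular_tetrahedron v 2) (hK : robert_body v K) :
  [/\ (forall f : E3 R -> E3 R, euclidean_isometry f ->
         f @` range v = range v -> f @` K = K),
      (forall x, boundary K x -> ~ range v x ->
         exists! P : set (E3 R), support_plane K x P)
    & (forall i, interior (normal_cone K (v i)) !=set0)].
Proof.
split.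
- exact: (body_symmetric hv hK).
- exact: (support_plane_unique hv hK).
- exact: (vertex_normal_cone hv hK).
Qed.
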